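(* There exist absolute constants $0<c\le C<\infty$ (independent of $p,d,\sigma,r$) such that $$c\le \mathfrak C^{\mathsf{MLE}}(r\mathsf B^d_p,\sigma)\le C$$ whenever $(\sigma,r,p,d)$ satisfies one of the following: (i) $p\in[2,\infty]$, with $\sigma,r>0$ and $d\ge1$ arbitrary; (ii) $d\ge1$, $p\in\big(0,1+\tfrac1{1+\log d}\big]$, with $\sigma,r>0$ arbitrary; (iii) $d\ge 1$, $p\in\big(1+\tfrac1{1+\log d},2\big)$, and $\sigma,r>0$ satisfy $\sigma\le\tfrac{r}{d^{1/p}}$ or $\sigma\ge\tfrac{r}{\sqrt{1+\log d}}$.
   Context: For $p\in(0,\infty)$, $\|x\|_p=(\sum_i|x_i|^p)^{1/p}$, and $\|x\|_\infty=\max_i|x_i|$; $r\mathsf{B}^d_p=\{x\in\mathbf{R}^d:\|x\|_p\le r\}$. Logarithms are natural. For a closed set $\Theta\subset\mathbf{R}^d$, $\Pi_\Theta(y)\in\arg\min_{\vartheta\in\Theta}\|\vartheta-y\|_2^2$ is the Euclidean projection (the maximum likelihood estimator, MLE, in the model $Y\sim\mathsf N(\theta^\star,\sigma^2I_d)$ with $\theta^\star\in\Theta$); for the nonconvex sets ($p<1$) it is almost surely unique under a Gaussian $Y$, and ties are broken arbitrarily (measurably). Define $$\mathcal R^{\mathsf{MLE}}(\Theta,\sigma)=\sup_{\theta^\star\in\Theta}\mathbf E_{Y\sim\mathsf N(\theta^\star,\sigma^2I_d)}\|\Pi_\Theta(Y)-\theta^\star\|_2^2,\qquad \mathcal M(\Theta,\sigma)=\inf_{\hat\theta}\sup_{\theta^\star\in\Theta}\mathbf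 E_{Y\sim\mathsf N(\theta^\star,\sigma^2I_d)}\|\hat\theta(Y)-\theta^\star\|_2^2,$$ the infimum being over all measurable $\hat\theta:\mathbf R^d\to\mathbf R^d$, and $\mathfrak C^{\mathsf{MLE}}(\Theta,\sigma)=\mathcal R^{\mathsf{MLE}}(\Theta,\sigma)/\mathcal M(\Theta,\sigma)$. *)

(* Defs.v *)
From HB Require Import structures.
From mathcomp Require Import all_boot all_order all_algebra.
From mathcomp Require Import all_classical all_reals all_analysis.

Set Implicit Arguments.
Unset Strict Implicit.
Unset Printing Implicit Defensive.

Import Order.TTheory GRing.Theory Num.Def Num.Theory.
Import numFieldTopology.Exports numFieldNormedType.Exports.

Local Open Scope classical_set_scope.
Local Open Scope ring_scope.

Section cons_pair.
Context d0 (T : measurableType d0) (n : nat).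

Definition cons_pair (x : T * n.-tuple T) : n.+1.-tuple T :=
  [tuple of x.1 :: x.2].

Let measurable_cons_pair : measurable_fun setT cons_pair.
Proof. exact: measurable_cons. Qed.

HB.instance Definition _ := @isMeasurableFun.Build _ _ _ _
  cons_pair measurable_cons_pair.

End cons_pair.

(* Product of finitely many probability measures; the library only has binary
   products. [tuple_probE] below is its characteristic property. *)
Fixpoint tuple_prob d0 (T : measurableType d0) (R : realType) (n : nat) :
    ('I_n -> probability T R) -> probability (n.-tuple T) R :=
  match n with
  | 0%N => fun=> \d_ [tuple]
  | m.+1 => fun P =>
      distribution
        (P ord0 \x tuple_prob (fun i : 'I_m => P (lift ord0 i)))%E
        (@cons_pair _ T m)
  end.

Lemma tuple_probE d0 (T : measurableType d0) (R : realType) (n : nat)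
    (P : 'I_n -> probability T R) (A : 'I_n -> set T) :
  (forall i, measurable (A i)) ->
  tuple_prob P [set y | forall i, A i (tnth y i)] =
  (\prod_(i < n) P i (A i))%E.
Proof.
elim: n P A => [|n IHn] P A mA /=.
  rewrite big_ord0 /= diracE mem_set//=; by case.
rewrite big_ord_recl /=.
rewrite -(IHn (fun i => P (lift ord0 i)) (fun i => A (lift ord0 i)))//.
rewrite /distribution /pushforward /=.
have mB : measurable
    [set y : n.-tuple T | forall i, A (lift ord0 i) (tnth y i)].
  rewrite (_ : mkset _ =
      \bigcap_(i in [set: 'I_n]) ((@tnth n T)^~ i @^-1` A (lift ord0 i))).
    apply: fin_bigcap_measurable => // i _.
    by rewrite -[X in measurable X]setTI; exact: measurable_tnth.
  by apply/seteqP; split=> [y /= h i _|y /= h i]; exact: h.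
rewrite -product_measure1E//; congr (_ _).
apply/seteqP; split=> -[x y] /=.
  move=> h; split=> /=; first by have := h ord0.
  by move=> i; have := h (lift ord0 i); rewrite tnthS.
move=> [hx hy] i.
by case: (unliftP ord0 i) => [j|] -> //=; rewrite tnthS.
Qed.

Section normal_probR.
Context (R : realType).

(* [normal_prob] lives on [measurableTypeR R], whose display differs from that
   of the canonical measurable structure of R (the sigma-algebras agree). *)
Definition idTR : measurableTypeR R -> R := idfun.

HB.instance Definition _ :=
  @isMeasurableFun.Build _ _ _ _ idTR (@measurable_id _ _ setT).

Definition normal_probR (m s : R) : probability R R :=
  distribution (normal_prob m s) idTR.

End normal_probR.

Section gaussian_sequence_model.
Context (R : realType) (d : nat).
Implicit Types (theta x y : d.-tuple R) (Theta : set (d.-tuple R)).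
Implicit Types (f : d.-tuple R -> d.-tuple R) (sigma r : R) (p : \bar R).

(* Junk value 0 at p = -oo. *)
Definition lpnorm p x : R :=
  match p with
  | q%:E => (\sum_(i < d) `|tnth x i| `^ q) `^ q^-1
  | +oo%E => \big[Num.max/0]_(i < d) `|tnth x i|
  | -oo%E => 0
  end.

Definition lpball p r : set (d.-tuple R) := [set x | lpnorm p x <= r].

Definition sqdist x y : R := \sum_(i < d) (tnth x i - tnth y i) ^+ 2.

(* N(theta, sigma^2 I_d): the second parameter of [normal_prob] is the
   standard deviation. *)
Definition gaussian theta sigma : probability (d.-tuple R) R :=
  tuple_prob (fun i => normal_probR (tnth theta i) sigma).

Lemma gaussianE theta sigma (A : 'I_d -> set R) :
  (forall i, measurable (A i)) ->
  gaussian theta sigma [set y | forall i, A i (tnth y i)] =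
  (\prod_(i < d) normal_prob (tnth theta i) sigma (A i))%E.
Proof. exact: tuple_probE. Qed.

Definition worst_risk Theta sigma f : \bar R :=
  ereal_sup [set ('E_(gaussian theta sigma)[fun y => sqdist (f y) theta])%E
            | theta in Theta].

Definition minimax_risk Theta sigma : \bar R :=
  ereal_inf [set worst_risk Theta sigma f | f in measurable_fun setT].

(* The argmin need not be a singleton when Theta is not convex: Pi is any
   measurable selection of it. *)
Definition is_projection Theta (Pi : d.-tuple R -> d.-tuple R) : Prop :=
  measurable_fun setT Pi /\
  forall y, Theta (Pi y) /\
    forall vartheta, Theta vartheta -> sqdist (Pi y) y <= sqdist vartheta y.

Definition mle_ratio Theta sigma (Pi : d.-tuple R -> d.-tuple R) : \bar R :=
  (worst_risk Theta sigma Pi / minimax_risk Theta sigma)%E.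

End gaussian_sequence_model.

Arguments lpball {R} d p r.

(* Main.v *)
(* The minimax risk is bounded below by a Bayes risk: split k m coordinates into
   k blocks of size m and let each block independently be 0 or a single spike
   tau at a uniform position. If tau^2 <= sigma^2 (1 + ln m) / 2, the chi-square
   distance between pure noise and the mixture of spiked blocks stays bounded,
   so each block costs a constant multiple of tau^2.
   For the MLE, |Pi(Y) - theta| <= 2 |Y - theta| and the diameter of the ball
   settle the extreme regimes. In the sparse regime (p <= 1, or p so close to 1
   that the ball is comparable to an l1 ball), the basic inequality
   |Delta|^2 <= 2 <Delta, Y - theta> is split at a noise level sigma * l: the
   noise below that level is absorbed by a t <= a^2/4 + 4 a^q t^(2-q), with
   q = min(p, 1), and the excess over it by AM-GM and the Gaussian tail. Taking
   l^2 of order 1 + ln (d sigma^q / r^q), which is of the same order as 1 + ln m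
   for k = (r / (sigma l))^q blocks of size m = d / k, matches the two bounds. *)

Require Import Defs.
From mathcomp Require Import all_boot all_order all_algebra.
From mathcomp Require Import all_classical all_reals all_analysis.
From mathcomp Require Import measurable_realfun ring lra.

Set Implicit Arguments.
Unset Strict Implicit.
Unset Printing Implicit Defensive.

Import Order.TTheory GRing.Theory Num.Def Num.Theory.
Import numFieldTopology.Exports numFieldNormedType.Exports.

Local Open Scope classical_set_scope.
Local Open Scope ring_scope.

(** * Gaussian integrals *)

Section real_nonneg_integrals.
Context d (T : measurableType d) (R : realType).
Variable mu : {measure set T -> \bar R}.
Implicit Types f g : T -> R.

Lemma ge0_integralZl_fin (k : R) f : measurable_fun setT f ->
  (forall x, 0 <= f x) -> 0 <= k ->
  (\int[mu]_x (k * f x)%:E = k%:E * \int[mu]_x (f x)%:E)%E.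
Proof.
move=> mf f0 k0; under eq_integral do rewrite EFinM.
by apply: ge0_integralZl => // [|x _]; [exact/measurable_EFinP|rewrite lee_fin].
Qed.

Lemma ge0_le_integral_fin f g :
  measurable_fun setT f -> measurable_fun setT g ->
  (forall x, 0 <= f x) -> (forall x, f x <= g x) ->
  (\int[mu]_x (f x)%:E <= \int[mu]_x (g x)%:E)%E.
Proof.
move=> mf mg f0 fg; apply: ge0_le_integral => //;
  solve [exact/measurable_EFinP | by move=> x _; rewrite lee_fin].
Qed.

Lemma ge0_integralD_fin f g : measurable_fun setT f -> measurable_fun setT g ->
  (forall x, 0 <= f x) -> (forall x, 0 <= g x) ->
  (\int[mu]_x (f x + g x)%:E = \int[mu]_x (f x)%:E + \int[mu]_x (g x)%:E)%E.
Proof.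
move=> mf mg f0 g0; under eq_integral do rewrite EFinD.
apply: ge0_integralD => //;
  solve [exact/measurable_EFinP | by move=> x _; rewrite lee_fin].
Qed.

Lemma ge0_integral_sum_fin (I : finType) (f : I -> T -> R) :
  (forall i, measurable_fun setT (f i)) -> (forall i x, 0 <= f i x) ->
  (\int[mu]_x (\sum_i f i x)%:E = \sum_i \int[mu]_x (f i x)%:E)%E.
Proof.
move=> mf f0; under eq_integral do rewrite -sumEFin.
apply: ge0_integral_sum => // [i|i x _]; last by rewrite lee_fin.
exact/measurable_EFinP.
Qed.

End real_nonneg_integrals.

Section normal_integrals.
Context (R : realType).
Implicit Types (m s t : R) (g : R -> \bar R).

(** The Radon-Nikodym derivative of [normal_prob] and [normal_pdf] have equal integrals over every
    measurable set, hence agree almost everywhere; a change of variables then yields a Lebesgue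
    integral. *)
Lemma ge0_integral_normal_probR m s g :
  measurable_fun setT g -> (forall x, (0 <= g x)%E) ->
  (\int[normal_probR m s]_x g x =
   \int[lebesgue_measure]_x (g x * (normal_pdf m s x)%:E))%E.
Proof.
move=> mg g0.
rewrite ge0_integral_pushforward//=.
rewrite preimage_setT.
have mg' : measurable_fun [set: measurableTypeR R] (g \o @idTR R).
  exact: measurableT_comp.
have nm := normal_prob_dominates m s.
rewrite -(@Radon_Nikodym_SigmaFinite.change_of_variables _ _ _ _ _ nm)//.
have mN : measurable_fun [set: measurableTypeR R]
    (fun x => (normal_pdf m s x)%:E).
  by apply/measurable_EFinP; exact: measurable_normal_pdf.
apply: ae_eq_integral => //=.
- apply: emeasurable_funM => //.
  exact: measurable_int (Radon_Nikodym_SigmaFinite.f_integrable _).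
- exact: emeasurable_funM.
- apply: ae_eqe_mul2l.
  apply: integral_ae_eq => //.
    exact: Radon_Nikodym_SigmaFinite.f_integrable.
  by move=> E _ mE; rewrite -Radon_Nikodym_SigmaFinite.f_integral.
Qed.

(* The likelihood ratio of N(m + t, s^2) with respect to N(m, s^2). *)
Definition tilt m s t x :=
  expR (t * (x - m) / s ^+ 2 - t ^+ 2 / (s ^+ 2 *+ 2)).

Lemma tilt_ge0 m s t x : 0 <= tilt m s t x.
Proof. exact: expR_ge0. Qed.

Lemma measurable_tilt m s t : measurable_fun setT (tilt m s t).
Proof.
apply: measurableT_comp => //; apply: measurable_funB => //.
apply: measurable_funM => //; apply: measurable_funM => //.
exact: measurable_funB.
Qed.

Lemma normal_pdf_shift m s t x : s != 0 ->
  normal_pdf (m + t) s x = tilt m s t x * normal_pdf m s x.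
Proof.
move=> s0; rewrite !normal_pdfE// mulrCA; congr (_ * _).
rewrite /normal_fun /tilt -expRD; congr expR.
by rewrite -mulr_natr; field.
Qed.

Lemma ge0_integral_normal_shift m s t g : s != 0 ->
  measurable_fun setT g -> (forall x, (0 <= g x)%E) ->
  (\int[normal_probR (m + t) s]_x g x =
   \int[normal_probR m s]_x (g x * (tilt m s t x)%:E))%E.
Proof.
move=> s0 mg g0.
rewrite [LHS]ge0_integral_normal_probR; [|exact: mg|exact: g0].
rewrite [RHS]ge0_integral_normal_probR.
- by apply: eq_integral => x _; rewrite -muleA -EFinM normal_pdf_shift.
- apply: emeasurable_funM => //.
  by apply/measurable_EFinP; exact: measurable_tilt.
- by move=> x; rewrite mule_ge0// lee_fin tilt_ge0.
Qed.

Lemma integral_tilt m s t : s != 0 ->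
  (\int[normal_probR m s]_x (tilt m s t x)%:E = 1)%E.
Proof.
move=> s0; rewrite -[RHS](@probability_setT _ _ _ (normal_probR (m + t) s)).
under eq_integral do rewrite -[_%:E]mul1e.
rewrite -(@ge0_integral_normal_shift m s t (cst 1%E))//.
by rewrite integral_cst// mul1e.
Qed.

(** This is the second moment of the likelihood ratio under the unshifted law, that is, one plus the
    chi-square divergence. Recentering [tilt] at [m + t] releases the factor
    [expR (t ^+ 2 / s ^+ 2)] and leaves a ratio of mean 1. *)
Lemma integral_tilt_shift m s t : s != 0 ->
  (\int[normal_probR (m + t) s]_x (tilt m s t x)%:E =
   (expR (t ^+ 2 / s ^+ 2))%:E)%E.
Proof.
move=> s0.
transitivity (\int[normal_probR (m + t) s]_x
    (expR (t ^+ 2 / s ^+ 2) * tilt (m + t) s t x)%:E)%E.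
  apply: eq_integral => x _; rewrite -expRD; congr (expR _)%:E.
  by rewrite -mulr_natr; field.
rewrite (ge0_integralZl_fin _ (@measurable_tilt _ _ _)
  (tilt_ge0 _ _ _)) ?expR_ge0//.
by rewrite integral_tilt// mule1.
Qed.

Lemma measurable_expR_sqr m c :
  measurable_fun setT (fun x : R => expR ((x - m) ^+ 2 / c)).
Proof.
apply: measurableT_comp => //; apply: measurable_funM => //.
by apply: measurable_funX; exact: measurable_funB.
Qed.

(** The exponential cancels half of the exponent of the density, which leaves [Num.sqrt 2] times the
    normal density of standard deviation [Num.sqrt 2 * s]. *)
Lemma integral_expR_sqr m s : 0 < s ->
  (\int[normal_probR m s]_x (expR ((x - m) ^+ 2 / (4 * s ^+ 2)))%:E =
   (Num.sqrt 2)%:E)%E.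
Proof.
move=> s0; rewrite ge0_integral_normal_probR; last 2 first.
- by apply/measurable_EFinP; exact: measurable_expR_sqr.
- by move=> x; rewrite lee_fin expR_ge0.
have r0 : 0 < Num.sqrt 2 * s :> R by rewrite mulr_gt0// sqrtr_gt0.
transitivity (\int[lebesgue_measure]_x
   (Num.sqrt 2 * normal_pdf m (Num.sqrt 2 * s) x)%:E)%E; last first.
  rewrite (@ge0_integralZl_fin _ (measurableTypeR R) R lebesgue_measure _ _
    (measurable_normal_pdf _ _) (normal_pdf_ge0 _ _)) ?sqrtr_ge0//.
  by rewrite integral_normal_pdf mule1.
apply: eq_integral => x _; rewrite -!EFinM; congr (_%:E).
rewrite !normal_pdfE ?gt_eqF//.
rewrite mulrCA [RHS]mulrA /normal_peak /normal_fun -expRD; congr (_ * _).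
  have -> : (Num.sqrt 2 * s) ^+ 2 * pi *+ 2 = 2 * (s ^+ 2 * pi *+ 2) :> R.
    by rewrite exprMn sqr_sqrtr//; ring.
  by rewrite sqrtrM// invfM mulVKf// gt_eqF// sqrtr_gt0.
rewrite exprMn sqr_sqrtr//; congr expR.
by field; rewrite gt_eqF.
Qed.

End normal_integrals.

(** For [|z| > l >= 0], [(|z| - l)^2 <= z^2 - l^2], and [u <= expR u] at [u = (z^2 - l^2) / 4]
    concludes. *)
Lemma sqr_excess_le_expR (R : realType) (l z : R) : 0 <= l ->
  (Num.max 0 (`|z| - l)) ^+ 2 <= 4 * expR (z ^+ 2 / 4) * expR (- (l ^+ 2 / 4)).
Proof.
move=> l0; rewrite -mulrA -expRD.
have [zl|lz] := leP (`|z| - l) 0.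
  by rewrite expr0n/= mulr_ge0// expR_ge0.
apply: (@le_trans _ _ (4 * (z ^+ 2 / 4 - l ^+ 2 / 4))); last first.
  by rewrite ler_wpM2l//; apply: le_trans (expR_ge1Dx _); rewrite lerDr.
rewrite -[z ^+ 2]real_normK ?num_real//; nra.
Qed.

Lemma integral_sqr_excess (R : realType) (m s l : R) : 0 < s -> 0 <= l ->
  (\int[normal_probR m s]_x ((Num.max 0 (`|x - m| - s * l)) ^+ 2)%:E <=
   (8 * s ^+ 2 * expR (- (l ^+ 2 / 4)))%:E)%E.
Proof.
move=> s0 l0.
have mE := @measurable_expR_sqr R m (4 * s ^+ 2).
apply: (@le_trans _ _ (\int[normal_probR m s]_x
   (4 * s ^+ 2 * expR (- (l ^+ 2 / 4)) *
     expR ((x - m) ^+ 2 / (4 * s ^+ 2)))%:E)%E).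
  apply: ge0_le_integral_fin.
  - apply: measurable_funX; apply: measurable_maxr => //.
    apply: measurable_funB => //; apply: measurableT_comp => //.
    exact: measurable_funB.
  - exact: measurable_funM.
  - by move=> x; exact: sqr_ge0.
  - move=> x.
    have /(ler_wpM2l (sqr_ge0 s)) := sqr_excess_le_expR ((x - m) / s) l0.
    congr (_ <= _).
      rewrite -exprMn maxr_pMr ?ltW// mulr0 mulrBr normrM.
      rewrite (gtr0_norm (x := s^-1)) ?invr_gt0//.
      by congr (Num.max _ (_ - _) ^+ _); field; rewrite gt_eqF.
    rewrite (_ : ((x - m) / s) ^+ 2 / 4 = (x - m) ^+ 2 / (4 * s ^+ 2)).
      ring.
    by field; rewrite gt_eqF.
have K0 : 0 <= 4 * s ^+ 2 * expR (- (l ^+ 2 / 4)).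
  by apply: mulr_ge0 (expR_ge0 _); apply: mulr_ge0 (sqr_ge0 _).
rewrite (ge0_integralZl_fin _ mE (fun x => expR_ge0 _) K0).
rewrite integral_expR_sqr// -EFinM lee_fin.
(* Rounding up [4 * Num.sqrt 2] gives the constant 8. *)
have : Num.sqrt 2 <= 2 :> R.
  have : Num.sqrt 2 ^+ 2 = 2 :> R by rewrite sqr_sqrtr.
  have := sqrtr_ge0 (2 : R); nra.
have : 0 <= s ^+ 2 * expR (- (l ^+ 2 / 4)).
  by rewrite mulr_ge0 ?sqr_ge0 ?expR_ge0.
nra.
Qed.
Lemma integral_probability_cst d (T : measurableType d) (R : realType)
  (P : probability T R) (c : \bar R) : (\int[P]_x c = c)%E.
Proof.
by rewrite -[RHS]mule1 -(probability_setT P) -integral_cst. Qed.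

(** * Integration against finite product measures *)

Section tuple_prob_integrals.
Context d0 (T : measurableType d0) (R : realType).

Lemma ge0_integral_tuple_prob_cons n (P : 'I_n.+1 -> probability T R)
    (g : n.+1.-tuple T -> \bar R) :
  measurable_fun setT g -> (forall y, (0 <= g y)%E) ->
  (\int[tuple_prob P]_y g y =
   \int[P ord0]_x \int[tuple_prob (fun i => P (lift ord0 i))]_y
     g [tuple of x :: y])%E.
Proof.
move=> mg g0; rewrite ge0_integral_pushforward//= preimage_setT.
have mgc : measurable_fun setT (g \o @cons_pair _ T n).
  exact: measurableT_comp.
by rewrite fubini_tonelli1// => x; exact: g0.
Qed.

(** A density for one factor is a density for the product. By induction with Tonelli: a changed tail
    factor is handled under the outer integral, a changed head factor by applying the hypothesis to
    the inner integral as a function of the head. *)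
Lemma ge0_integral_tuple_prob_tilt n (P P' : 'I_n -> probability T R) (i : 'I_n)
    (L : T -> R) :
  measurable_fun setT L -> (forall x, 0 <= L x) ->
  (forall j, j != i -> P' j = P j) ->
  (forall g : T -> \bar R, measurable_fun setT g -> (forall x, (0 <= g x)%E) ->
    (\int[P' i]_x g x = \int[P i]_x (g x * (L x)%:E))%E) ->
  forall g : n.-tuple T -> \bar R,
  measurable_fun setT g -> (forall y, (0 <= g y)%E) ->
  (\int[tuple_prob P']_y g y =
   \int[tuple_prob P]_y (g y * (L (tnth y i))%:E))%E.
Proof.
move=> mL L0; elim: n => [|n IHn] in P P' i *; first by case: i.
move=> eqP tiltP g mg g0.
have mgL : measurable_fun setT
    (fun y : n.+1.-tuple T => g y * (L (tnth y i))%:E)%E.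
  apply: emeasurable_funM => //; apply/measurable_EFinP.
  by apply: measurableT_comp => //; exact: measurable_tnth.
rewrite ge0_integral_tuple_prob_cons//.
rewrite [RHS]ge0_integral_tuple_prob_cons//; last first.
  by move=> y; rewrite mule_ge0// lee_fin.
have mgx x : measurable_fun setT (fun y : n.-tuple T => g [tuple of x :: y]).
  by apply: measurableT_comp => //; exact: measurable_cons.
case: (unliftP ord0 i) => [j ij|i0].
  have eq0 : P' ord0 = P ord0 by apply: eqP; rewrite ij neq_lift.
  rewrite eq0; apply: eq_integral => x _.
  rewrite (IHn (fun k => P (lift ord0 k)) _ j)//.
  - by apply: eq_integral => y _; rewrite ij tnthS.
  - by move=> k kj; apply: eqP; rewrite ij (inj_eq lift_inj).
  - by rewrite -ij.
have eqt : (fun k : 'I_n => P' (lift ord0 k)) = (fun k => P (lift ord0 k)).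
  by apply/funext => k; apply: eqP; rewrite i0 eq_sym neq_lift.
have mF : measurable_fun setT (fun x =>
    \int[tuple_prob (fun k => P (lift ord0 k))]_y g [tuple of x :: y])%E.
  have mgc : measurable_fun setT (g \o @cons_pair _ T n).
    exact: measurableT_comp.
  exact: (measurable_fun_fubini_tonelli_F _ mgc (fun x => g0 _)).
rewrite eqt -i0 tiltP; [|by rewrite i0; exact: mF|]; last first.
  by move=> x; apply: integral_ge0.
apply: eq_integral => x _; rewrite -ge0_integralZr ?lee_fin//.
by apply: eq_integral => y _; rewrite i0.
Qed.

Lemma ge0_integral_tuple_prob_tnth n (P : 'I_n -> probability T R) (i : 'I_n)
    (h : T -> \bar R) :
  measurable_fun setT h -> (forall x, (0 <= h x)%E) ->
  (\int[tuple_prob P]_y h (tnth y i) = \int[P i]_x h x)%E.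
Proof.
move=> mh h0; elim: n => [|n IHn] in P i *; first by case: i.
rewrite ge0_integral_tuple_prob_cons//; last first.
  by apply: measurableT_comp => //; exact: measurable_tnth.
case: (unliftP ord0 i) => [j ->|->].
  under eq_integral do under eq_integral do rewrite tnthS.
  by rewrite IHn integral_probability_cst.
apply: eq_integral => x _.
by rewrite (eq_integral (cst (h x)))//= integral_probability_cst.
Qed.

End tuple_prob_integrals.

(** * Risk bounds and change of measure in the Gaussian sequence model *)

Section gaussian_integrals.
Context (R : realType) (d : nat).
Implicit Types (theta : d.-tuple R) (sigma : R) (f : d.-tuple R -> d.-tuple R).

Lemma measurable_tnth_comp f (i : 'I_d) : measurable_fun setT f ->
  measurable_fun setT (fun y => tnth (f y) i).
Proof.
move=> mf.
apply: (measurableT_comp (f := fun x : d.-tuple R => tnth x i)) => //.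
exact: measurable_tnth.
Qed.

Lemma measurable_sqdist f theta : measurable_fun setT f ->
  measurable_fun setT (fun y => sqdist (f y) theta).
Proof.
move=> mf; apply: measurable_sum => i; apply: measurable_funX.
by apply: measurable_funB => //; exact: measurable_tnth_comp.
Qed.

Lemma sqdist_ge0 (x y : d.-tuple R) : 0 <= sqdist x y.
Proof. by apply: sumr_ge0 => i _; exact: sqr_ge0. Qed.

(** The common form of the upper bounds on the risk of the MLE: a deterministic part [A] plus the
    noise in excess of level [sigma * l]. Taking [B = 0] gives diameter bounds, and [l = 0] counts
    all of the noise. *)
Lemma gaussian_risk_le theta sigma (l A B : R) f :
  0 < sigma -> 0 <= l -> 0 <= A -> 0 <= B -> measurable_fun setT f ->
  (forall y, sqdist (f y) theta <=
    A + B * \sum_i (Num.max 0 (`|tnth y i - tnth theta i| - sigma * l)) ^+ 2) ->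
  ('E_(gaussian theta sigma)[fun y => sqdist (f y) theta] <=
    (A + B * (d%:R * (8 * sigma ^+ 2 * expR (- (l ^+ 2 / 4)))))%:E)%E.
Proof.
move=> s0 l0 A0 B0 mf fub; rewrite unlock.
set e := fun (i : 'I_d) (x : R) =>
  (Num.max 0 (`|x - tnth theta i| - sigma * l)) ^+ 2.
have me i : measurable_fun setT (e i).
  apply: measurable_funX; apply: measurable_maxr => //.
  apply: measurable_funB => //; apply: measurableT_comp => //.
  exact: measurable_funB.
have e0 i x : 0 <= e i x by exact: sqr_ge0.
have mey i : measurable_fun setT (fun y : d.-tuple R => e i (tnth y i)).
  by apply: measurableT_comp => //; exact: measurable_tnth.
have mse : measurable_fun setT (fun y : d.-tuple R => \sum_i e i (tnth y i)).
  exact: measurable_sum.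
have se0 (y : d.-tuple R) : 0 <= \sum_i e i (tnth y i) by apply: sumr_ge0.
apply: (le_trans (ge0_le_integral_fin _ _ _ (fun y => sqdist_ge0 _ _) fub)).
- exact: measurable_sqdist.
- by apply: measurable_funD => //; exact: measurable_funM.
have mB : measurable_fun setT
  (fun y : d.-tuple R => B * \sum_i e i (tnth y i)) by exact: measurable_funM.
rewrite (ge0_integralD_fin _ (measurable_cst A) mB (fun=> A0)); last first.
  by move=> y; rewrite mulr_ge0.
rewrite EFinD; apply: leeD.
  by rewrite -[leRHS](integral_probability_cst (gaussian theta sigma)).
rewrite ge0_integralZl_fin// EFinM lee_wpmul2l ?lee_fin//.
rewrite ge0_integral_sum_fin//.
apply: (@le_trans _ _
  (\sum_(i < d) (8 * sigma ^+ 2 * expR (- (l ^+ 2 / 4)))%:E)%E).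
  apply: lee_sum => i _.
  rewrite (ge0_integral_tuple_prob_tnth _ _ (h := EFin \o e i)).
  - exact: integral_sqr_excess.
  - exact/measurable_EFinP.
  - by move=> x; rewrite lee_fin.
by rewrite sumEFin lee_fin sumr_const card_ord -[_ *+ d]mulr_natl.
Qed.

Lemma ge0_integral_gaussian_shift theta theta' sigma (i : 'I_d) (t : R)
    (g : d.-tuple R -> R) :
  sigma != 0 -> tnth theta' i = tnth theta i + t ->
  (forall j, j != i -> tnth theta' j = tnth theta j) ->
  measurable_fun setT g -> (forall y, 0 <= g y) ->
  (\int[gaussian theta' sigma]_y (g y)%:E =
   \int[gaussian theta sigma]_y
     (g y * tilt (tnth theta i) sigma t (tnth y i))%:E)%E.
Proof.
move=> s0 ti tj mg g0.
rewrite [LHS](ge0_integral_tuple_prob_tilt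
  (P := fun i => normal_probR (tnth theta i) sigma)
  (i := i) (L := tilt (tnth theta i) sigma t)).
- by apply: eq_integral => y _; rewrite EFinM.
- exact: measurable_tilt.
- by move=> x; exact: tilt_ge0.
- by move=> j ji; rewrite tj.
- by move=> h mh h0; rewrite ti; exact: ge0_integral_normal_shift.
- exact/measurable_EFinP.
- by move=> y; rewrite lee_fin.
Qed.

Lemma integral_gaussian_tnth theta sigma (i : 'I_d) (h : R -> R) :
  measurable_fun setT h -> (forall x, 0 <= h x) ->
  (\int[gaussian theta sigma]_y (h (tnth y i))%:E =
   \int[normal_probR (tnth theta i) sigma]_x (h x)%:E)%E.
Proof.
move=> mh h0; rewrite (ge0_integral_tuple_prob_tnth _ _ (h := EFin \o h))//.
exact/measurable_EFinP.
Qed.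

End gaussian_integrals.

(* A and B j are the losses when a block is zero and when its j-th coordinate is
   spiked, L j the likelihood ratios, u their mean: the first two terms on the
   right are at least m T min(1, u), and min(1, u) >= u - u^2/4. *)
Lemma sum_tilted_risk_ge (R : realType) (m : nat) (A T : R) (B L : 'I_m -> R) :
  (0 < m)%N -> 0 <= T -> 0 <= A ->
  (forall j, 0 <= B j) -> (forall j, 0 <= L j) ->
  (forall j, T <= A + B j) ->
  T * \sum_j L j <=
  m%:R * A + \sum_j B j * L j + T / (4 * m%:R) * (\sum_j L j) ^+ 2.
Proof.
move=> m0 T0 A0 B0 L0 TAB.
set S := \sum_j L j; set Q := \sum_j B j * L j.
have m0' : 0 < m%:R :> R by rewrite ltr0n.
have S0 : 0 <= S by apply: sumr_ge0.
have Q0 : 0 <= Q by apply: sumr_ge0 => j _; rewrite mulr_ge0.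
have TS : T * S <= A * S + Q.
  rewrite /S /Q !mulr_sumr -big_split/=; apply: ler_sum => j _.
  by rewrite -mulrDl ler_wpM2r.
have [Sm|/ltW mS] := leP S m%:R.
  apply: (le_trans TS); rewrite (@le_trans _ _ (m%:R * A + Q))//.
    by rewrite lerD2r mulrC ler_wpM2r.
  by rewrite lerDl mulr_ge0 ?sqr_ge0// divr_ge0// mulr_ge0.
have S1 : 0 < S by exact: lt_le_trans mS.
have Tm : T * m%:R <= m%:R * A + Q.
  have /(ler_wpM2r (divr_ge0 (ltW m0') S0)) := TS.
  rewrite (_ : T * S * _ = T * m%:R); last by field; rewrite gt_eqF.
  move=> /le_trans; apply.
  rewrite mulrDl (_ : A * S * _ = m%:R * A); last by field; rewrite gt_eqF.
  by rewrite lerD2l ler_piMr// ler_pdivrMr// mul1r.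
(* With [u = S / m], what remains is [u - u^2 / 4 <= 1], a perfect square vanishing at [u = 2]. *)
rewrite -subr_ge0.
have -> : m%:R * A + Q + T / (4 * m%:R) * S ^+ 2 - T * S =
    m%:R * A + Q - T * m%:R + T / (4 * m%:R) * (S - 2 * m%:R) ^+ 2.
  by field; rewrite gt_eqF.
by rewrite addr_ge0 ?subr_ge0// mulr_ge0 ?sqr_ge0// divr_ge0// mulr_ge0.
Qed.

(** * Bayes risk of a single block *)

Section block_bayes_risk.
Context (R : realType) (d m : nat).
Variables (theta0 : d.-tuple R) (theta1 : 'I_m -> d.-tuple R).
Variables (i : 'I_m -> 'I_d) (sigma tau : R) (F : 'I_m -> d.-tuple R -> R).
Hypothesis m0 : (0 < m)%N.
Hypothesis i_inj : injective i.
Hypothesis s0 : 0 < sigma.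
Hypothesis theta1_i : forall j, tnth (theta1 j) (i j) = tnth theta0 (i j) + tau.
Hypothesis theta1_other : forall j l, l != i j ->
  tnth (theta1 j) l = tnth theta0 l.
Hypothesis mF : forall j, measurable_fun setT (F j).
Hypothesis tau_le : expR (tau ^+ 2 / sigma ^+ 2) <= m%:R + 1.

Let s_neq0 : sigma != 0. Proof. by rewrite gt_eqF. Qed.
Let L j (y : d.-tuple R) := tilt (tnth theta0 (i j)) sigma tau (tnth y (i j)).
Let L0 j y : 0 <= L j y. Proof. exact: tilt_ge0. Qed.
Let mL j : measurable_fun setT (L j).
Proof.
by apply: measurableT_comp; [exact: measurable_tilt|exact: measurable_tnth].
Qed.

Let Q0 := gaussian theta0 sigma.
Let Q1 j := gaussian (theta1 j) sigma.

Let integralL j : (\int[Q0]_y (L j y)%:E = 1)%E.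
Proof.
rewrite (integral_gaussian_tnth _ _ _ (@measurable_tilt _ _ _ _)
  (tilt_ge0 _ _ _)).
exact: integral_tilt.
Qed.

(** Absorbing [L j] into the measure shifts only coordinate [i j], so [L l] keeps mean 1 unless
    [l = j]. *)
Let integralLL j l : (\int[Q0]_y (L l y * L j y)%:E =
  (if l == j then expR (tau ^+ 2 / sigma ^+ 2) else 1)%:E)%E.
Proof.
apply: etrans (esym (ge0_integral_gaussian_shift s_neq0 (theta1_i j)
  (@theta1_other j) (mL l) (L0 l))) _.
rewrite (integral_gaussian_tnth _ _ _ (@measurable_tilt _ _ _ _)
  (tilt_ge0 _ _ _)).
case: eqVneq => [->|lj]; first by rewrite theta1_i integral_tilt_shift.
by rewrite theta1_other ?(inj_eq i_inj)// integral_tilt.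
Qed.

(** There are [m] diagonal terms, each at most [m + 1] by [tau_le], and [m (m - 1)] off-diagonal
    terms equal to 1: in total at most [2 m^2]. *)
Let integral_sqr_sumL :
  (\int[Q0]_y ((\sum_j L j y) ^+ 2)%:E <= (2 * m%:R ^+ 2)%:E)%E.
Proof.
have mS : measurable_fun setT (fun y => \sum_j L j y) by exact: measurable_sum.
have eqS y : (\sum_j L j y) ^+ 2 = \sum_j \sum_l L l y * L j y.
  by rewrite expr2 mulr_sumr; apply: eq_bigr => j _; rewrite mulr_suml.
under eq_integral do rewrite eqS.
rewrite ge0_integral_sum_fin; last 2 first.
- by move=> j; apply: measurable_sum => l; exact: measurable_funM.
- by move=> j y; apply: sumr_ge0 => l _; exact: mulr_ge0.
have -> : (2 * m%:R ^+ 2)%:E = (\sum_(j < m) (2 * m%:R : R)%:E)%E.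
  by rewrite sumEFin sumr_const card_ord -[_ *+ m]mulr_natl; congr (_%:E); ring.
apply: lee_sum => j _.
rewrite ge0_integral_sum_fin; last 2 first.
- by move=> l; exact: measurable_funM.
- by move=> l y; exact: mulr_ge0.
under eq_bigr do rewrite integralLL.
rewrite sumEFin lee_fin (bigD1 j)//= eqxx.
under eq_bigr => l /negbTE -> do [].
rewrite sumr_const (_ : #|_| = m.-1); last first.
  by rewrite (cardC1 j) card_ord.
have : (m.-1)%:R = m%:R - 1 :> R by rewrite -subn1 natrB.
by move=> ->; have := tau_le; lra.
Qed.

(** Up to normalization, the prior puts mass 1/2 on the zero block and [1 / (2 m)] on each spike.
    Change of measure brings all integrals to [Q0], where [sum_tilted_risk_ge] applies pointwise
    with [T = tau^2 / 2]; integrated, it leaves [m tau^2 / 2 - m tau^2 / 4]. *)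
Lemma block_bayes_risk :
  ((m%:R * tau ^+ 2 / 4)%:E <=
   \sum_j (\int[Q0]_y (\sum_l F l y ^+ 2)%:E +
           \int[Q1 j]_y (\sum_l (F l y - tau *+ (l == j)) ^+ 2)%:E))%E.
Proof.
pose A y := \sum_l F l y ^+ 2.
pose B j y := \sum_l (F l y - tau *+ (l == j)) ^+ 2.
have A0 y : 0 <= A y by apply: sumr_ge0 => l _; exact: sqr_ge0.
have B0 j y : 0 <= B j y by apply: sumr_ge0 => l _; exact: sqr_ge0.
have mA : measurable_fun setT A.
  by apply: measurable_sum => l; exact: measurable_funX.
have mB j : measurable_fun setT (B j).
  by apply: measurable_sum => l; apply: measurable_funX; exact: measurable_funB.
(* Coordinate [j] alone suffices: [x^2 + (x - tau)^2 >= tau^2 / 2]. *)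
have AB j y : tau ^+ 2 / 2 <= A y + B j y.
  rewrite /A /B (bigD1 j)//= [X in _ + X](bigD1 j)//= eqxx mulr1n.
  set a := \sum_(_ | _) _; set b := \sum_(_ | _) _.
  have a0 : 0 <= a by apply: sumr_ge0 => l _; exact: sqr_ge0.
  have b0 : 0 <= b by apply: sumr_ge0 => l _; exact: sqr_ge0.
  by have := sqr_ge0 (2 * F j y - tau); nra.
have mBL : measurable_fun setT (fun y => \sum_j B j y * L j y).
  by apply: measurable_sum => j; exact: measurable_funM.
have BL0 y : 0 <= \sum_j B j y * L j y.
  by apply: sumr_ge0 => j _; exact: mulr_ge0.
have mmA : measurable_fun setT (fun y => m%:R * A y) by exact: measurable_funM.
have mA0 y : 0 <= m%:R * A y by exact: mulr_ge0.
have T0 : 0 <= tau ^+ 2 / 2 by rewrite divr_ge0 ?sqr_ge0.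
have mS : measurable_fun setT (fun y => \sum_j L j y) by exact: measurable_sum.
have S0 y : 0 <= \sum_j L j y by apply: sumr_ge0.
pose K := tau ^+ 2 / 2 / (4 * m%:R).
have K0 : 0 <= K by rewrite !divr_ge0 ?sqr_ge0.
have mKS : measurable_fun setT (fun y => K * (\sum_j L j y) ^+ 2).
  by apply: measurable_funM => //; exact: measurable_funX.
have KS0 y : 0 <= K * (\sum_j L j y) ^+ 2 by rewrite mulr_ge0 ?sqr_ge0.
have -> : (\sum_j (\int[Q0]_y (A y)%:E + \int[Q1 j]_y (B j y)%:E) =
    \int[Q0]_y (m%:R * A y + \sum_j B j y * L j y)%:E)%E.
  rewrite [RHS](ge0_integralD_fin _ mmA mBL mA0 BL0) big_split/=.
  congr (_ + _)%E.
    rewrite -(ge0_integral_sum_fin Q0 (fun=> mA) (fun=> A0)).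
    by apply: eq_integral => y _; rewrite sumr_const card_ord mulr_natl.
  rewrite [RHS]ge0_integral_sum_fin; last 2 first.
  - by move=> j; exact: measurable_funM.
  - by move=> j y; exact: mulr_ge0.
  apply: eq_bigr => j _.
  exact: (ge0_integral_gaussian_shift s_neq0 (theta1_i j) (@theta1_other j)).
have KSle : (\int[Q0]_y (K * (\sum_j L j y) ^+ 2)%:E <=
    (m%:R * tau ^+ 2 / 4)%:E)%E.
  rewrite ge0_integralZl_fin//;
    [|exact: measurable_funX|by move=> y; exact: sqr_ge0].
  apply: (le_trans (lee_wpmul2l _ integral_sqr_sumL)); first by rewrite lee_fin.
  rewrite -EFinM lee_fin le_eqVlt; apply/orP; left; apply/eqP.
  by rewrite /K; field; rewrite pnatr_eq0 -lt0n.
have : (\int[Q0]_y (tau ^+ 2 / 2 * \sum_j L j y)%:E <=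
   \int[Q0]_y (m%:R * A y + \sum_j B j y * L j y)%:E +
   \int[Q0]_y (K * (\sum_j L j y) ^+ 2)%:E)%E.
  rewrite -ge0_integralD_fin//; last 2 first.
  - exact: measurable_funD.
  - by move=> y; exact: addr_ge0.
  apply: ge0_le_integral_fin.
  - exact: measurable_funM.
  - by apply: measurable_funD => //; exact: measurable_funD.
  - by move=> y; rewrite mulr_ge0.
  - by move=> y; exact: sum_tilted_risk_ge.
rewrite (ge0_integralZl_fin _ mS S0)// ge0_integral_sum_fin//.
under eq_bigr do rewrite integralL.
rewrite sumEFin sumr_const card_ord -EFinM => /le_trans/(_ (leeD2l _ KSle)).
rewrite -leeBlDr// -EFinB; apply: le_trans; rewrite lee_fin; lra.
Qed.

End block_bayes_risk.
Lemma expectation_integral d (T : measurableType d) (R : realType)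
  (P : probability T R) (X : T -> R) : ('E_P[X] = \int[P]_x (X x)%:E)%E.
Proof. by rewrite unlock. Qed.

(** * Minimax lower bound from a block-sparse prior *)

Section sparse_lower_bound.
Context (R : realType) (k m d : nat).
Variables (pos : 'I_k -> 'I_m -> 'I_d) (sigma tau : R).
Hypothesis m0 : (0 < m)%N.
Hypothesis pos_inj : forall a b a' b', pos a b = pos a' b' -> a = a' /\ b = b'.
Hypothesis s0 : 0 < sigma.
Hypothesis tau_le : expR (tau ^+ 2 / sigma ^+ 2) <= m%:R + 1.

Let state := {ffun 'I_k -> 'I_m * bool}.

(* A block in state (b, e) is spiked at its b-th coordinate if e, zero otherwise;
   the uniform law on states thus gives probability 1/2 to the zero block. *)
Definition spike (s : {ffun 'I_k -> 'I_m * bool}) : d.-tuple R :=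
  [tuple tau *+ [exists a, (s a).2 && (pos a (s a).1 == i)] | i < d].

Definition set_block (s : {ffun 'I_k -> 'I_m * bool}) (a : 'I_k)
    (u : 'I_m * bool) :
    {ffun 'I_k -> 'I_m * bool} := [ffun b => if b == a then u else s b].

Lemma sum_set_block (a : 'I_k) (G : state -> \bar R) :
  (\sum_s \sum_u G (set_block s a u) = \sum_s \sum_(u : 'I_m * bool) G s)%E.
Proof.
(* Swapping u with the state of block a is an involution of the pairs (s, u). *)
pose h (x : state * ('I_m * bool)) := (set_block x.1 a x.2, x.1 a).
have hK : cancel h h.
  move=> [s u]; rewrite /h/=; congr (_, _); last by rewrite ffunE eqxx.
  by apply/ffunP => b; rewrite !ffunE; case: eqVneq => [->|].
rewrite !pair_bigA/= [RHS](reindex h)/=; last by exists h => x _; exact: hK.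
by [].
Qed.

Lemma spike_pos s a b : tnth (spike s) (pos a b) = tau *+ (s a == (b, true)).
Proof.
rewrite tnth_mktuple; congr (_ *+ nat_of_bool _).
apply/existsP/eqP => [[a' /andP[sa' /eqP/pos_inj[<- <-]]]|sa].
  by rewrite -sa' -surjective_pairing.
by exists a; rewrite sa/= eqxx.
Qed.

Variable f : d.-tuple R -> d.-tuple R.
Hypothesis mf : measurable_fun setT f.

Let loss a (s : state) y : R :=
  \sum_b (tnth (f y) (pos a b) - tnth (spike s) (pos a b)) ^+ 2.

Let risk a (s : state) : \bar R :=
  (\int[gaussian (spike s) sigma]_y (loss a s y)%:E)%E.

Let loss_ge0 a s y : 0 <= loss a s y.
Proof. by apply: sumr_ge0 => b _; exact: sqr_ge0. Qed.

Let measurable_loss a s : measurable_fun setT (loss a s).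
Proof.
apply: measurable_sum => b; apply: measurable_funX.
by apply: measurable_funB => //; exact: measurable_tnth_comp.
Qed.

(** By injectivity of [pos] the blocks are disjoint, so their losses add up to a part of the total;
    coordinates outside the blocks are dropped. *)
Let sum_loss_le s y : \sum_a loss a s y <= sqdist (f y) (spike s).
Proof.
rewrite /loss pair_bigA/=.
pose g i := (tnth (f y) i - tnth (spike s) i) ^+ 2.
pose j (x : 'I_k * 'I_m) := pos x.1 x.2.
have j_inj : injective j by move=> [a b] [a' b'] /pos_inj[/= -> ->].
have <- : \sum_(i in [set j x | x in [set: 'I_k * 'I_m]%SET]%SET) g i =
    \sum_x g (j x).
  rewrite big_imset/=; last by move=> x x' _ _; exact: j_inj.
  by apply: eq_bigl => x; rewrite inE.
rewrite /sqdist.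
rewrite [leRHS](bigID [in [set j x | x in [set: 'I_k * 'I_m]%SET]%SET])/=.
by rewrite lerDl; apply: sumr_ge0 => i _; exact: sqr_ge0.
Qed.

Let measurable_sum_loss s : measurable_fun setT (fun y => \sum_a loss a s y).
Proof. by apply: measurable_sum => a; exact: measurable_loss. Qed.

Let sum_risk_le s :
  (\sum_a risk a s <=
   'E_(gaussian (spike s) sigma)[fun y => sqdist (f y) (spike s)])%E.
Proof.
have -> : (\sum_a risk a s =
    \int[gaussian (spike s) sigma]_y (\sum_a loss a s y)%:E)%E.
  by rewrite ge0_integral_sum_fin.
rewrite expectation_integral.
apply: ge0_le_integral_fin => //.
- exact: measurable_sqdist.
- by move=> y; exact: sumr_ge0.
Qed.

(** With the other blocks frozen, only block [a] is random. The [m] states [(b, false)] all give the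
    same [theta0], which supplies the [m] copies of the zero block in [block_bayes_risk]. *)
Let sum_risk_ge a s :
  ((m%:R * tau ^+ 2 / 4)%:E <= \sum_u risk a (set_block s a u))%E.
Proof.
pose b0 := Ordinal m0.
pose theta0 := spike (set_block s a (b0, false)).
have spikeF b : spike (set_block s a (b, false)) = theta0.
  apply: eq_from_tnth => i; rewrite !tnth_mktuple; congr (_ *+ nat_of_bool _).
  by apply: eq_existsb => a'; rewrite !ffunE; case: eqVneq.
have other b i : i != pos a b ->
    tnth (spike (set_block s a (b, true))) i = tnth theta0 i.
  move=> iab; rewrite !tnth_mktuple; congr (_ *+ nat_of_bool _).
  apply: eq_existsb => a'; rewrite !ffunE; case: eqVneq => //= ->.
  by rewrite eq_sym (negbTE iab).
have spiked b : tnth (spike (set_block s a (b, true))) (pos a b) =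
    tnth theta0 (pos a b) + tau.
  by rewrite !spike_pos !ffunE eqxx eqxx/= xpair_eqE andbF add0r.
have pos_a_inj : injective (pos a) by move=> b b' /pos_inj[].
have := block_bayes_risk m0 pos_a_inj s0 spiked other
  (fun b => measurable_tnth_comp (pos a b) mf) tau_le.
move=> /le_trans; apply.
have <- : (\sum_b \sum_t risk a (set_block s a (b, t)) =
    \sum_u risk a (set_block s a u))%E.
  by rewrite pair_bigA; apply: eq_bigr => -[].
apply: lee_sum => b _; rewrite big_bool/= [leRHS]addeC; apply: leeD.
  rewrite /risk spikeF le_eqVlt; apply/orP; left; apply/eqP.
  apply: eq_integral => y _; congr (_%:E); apply: eq_bigr => l _.
  by rewrite spike_pos ffunE eqxx xpair_eqE andbF subr0.
rewrite /risk le_eqVlt; apply/orP; left; apply/eqP.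
apply: eq_integral => y _; congr (_%:E); apply: eq_bigr => l _.
by rewrite spike_pos ffunE eqxx xpair_eqE eqxx andbT eq_sym.
Qed.

(** A Bayes risk is at most the worst risk. Averages are kept as sums over states and over the [2 m]
    values of a resampled block, so [k m tau^2 / 4] is compared with [2 m W]. *)
Lemma worst_risk_ge (Theta : set (d.-tuple R)) : (forall s, Theta (spike s)) ->
  ((k%:R * tau ^+ 2 / 8)%:E <= worst_risk Theta sigma f)%E.
Proof.
move=> Theta_spike.
have risk_le s : (\sum_a risk a s <= worst_risk Theta sigma f)%E.
  apply: (le_trans (sum_risk_le s)); apply: ereal_sup_ubound.
  by exists (spike s).
move: (worst_risk Theta sigma f) risk_le => W risk_le.
have : (\sum_(a < k) \sum_(s : state) (m%:R * tau ^+ 2 / 4)%:E <=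
        \sum_(s : state) \sum_(u : 'I_m * bool) W)%E.
  apply: (@le_trans _ _ (\sum_a \sum_s \sum_u risk a (set_block s a u))%E).
    by do 2 (apply: lee_sum => ? _); exact: sum_risk_ge.
  (* Resampling block [a] preserves the uniform law on states, so the risks may be taken at [s]
     itself and summed over the blocks. *)
  under eq_bigr do rewrite sum_set_block.
  rewrite exchange_big/=; apply: lee_sum => s _.
  by rewrite exchange_big/=; apply: lee_sum => u _; exact: risk_le.
have s : state by exact: [ffun=> (Ordinal m0, true)].
have : (0 <= W)%E.
  apply: le_trans (risk_le s); apply: sume_ge0 => a _.
  by apply: integral_ge0 => y _; rewrite lee_fin.
case: W risk_le => [w| |]// _ _; last by rewrite leey.
under eq_bigr do rewrite sumEFin.
under [leRHS]eq_bigr do rewrite sumEFin.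
rewrite !sumEFin !lee_fin !sumr_const !card_prod card_bool !card_ord.
have : 0 < #|{: state}|%:R * m%:R :> R.
  by rewrite mulr_gt0 ?ltr0n//; apply/card_gt0P; exists s.
move: #|_| => N Nm0 H; rewrite -(ler_pM2l Nm0).
have {H} : N%:R * m%:R * (k%:R * tau ^+ 2 / 4) <= N%:R * m%:R * (2 * w).
  by move: H; congr (_ <= _); ring.
lra.
Qed.

End sparse_lower_bound.
(** The bound [1 + x <= expR x] at [x = -1/2] gives [expR (1/2) <= 2]; then square. *)
Lemma expR1_le4 (R : realType) : expR 1 <= 4 :> R.
Proof.
have e0 := expR_ge0 (2^-1 : R).
have e2 : expR 2^-1 <= 2 :> R.
  have : expR (- 2^-1) * expR 2^-1 = 1 :> R by rewrite -expRD addNr expR0.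
  have : 2^-1 <= expR (- 2^-1) :> R.
    by apply: le_trans (expR_ge1Dx _); lra.
  nra.
have -> : expR 1 = expR 2^-1 * expR 2^-1 :> R.
  by rewrite -expRD; congr expR; lra.
nra.
Qed.

Section sparse_minimax.
Context (R : realType) (d : nat).
Implicit Types (x : d.-tuple R) (Theta : set (d.-tuple R)) (sigma tau : R).

Definition two_valued tau x := forall i, tnth x i = 0 \/ tnth x i = tau.

Definition sparsity x : nat := #|[set i | tnth x i != 0]%SET|.

Lemma spike_two_valued k m (pos : 'I_k -> 'I_m -> 'I_d) tau s :
  two_valued tau (spike pos tau s).
Proof.
by move=> i; rewrite tnth_mktuple; case: [exists _, _]; [right|left].
Qed.

Lemma sparsity_spike k m (pos : 'I_k -> 'I_m -> 'I_d) tau s :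
  (sparsity (spike pos tau s) <= k)%N.
Proof.
rewrite -[leqRHS]card_ord -[leqRHS]cardsT.
apply: leq_trans (leq_imset_card (fun a => pos a (s a).1) _).
apply/subset_leq_card/fintype.subsetP => i; rewrite inE tnth_mktuple.
case: existsP => [[a /andP[_ /eqP <-]] _|_]; last by rewrite eqxx.
by apply: imset_f; rewrite inE.
Qed.

(** The blocks are consecutive intervals of length [m], told apart by Euclidean division. The
    condition on [tau] is a convenient form of the chi-square condition of [worst_risk_ge]. *)
Lemma minimax_risk_sparse_ge k m Theta sigma tau :
  (0 < m)%N -> (k * m <= d)%N -> 0 < sigma ->
  tau ^+ 2 <= sigma ^+ 2 * (1 + ln m%:R) / 2 ->
  (forall x, two_valued tau x -> (sparsity x <= k)%N -> Theta x) ->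
  ((k%:R * tau ^+ 2 / 8)%:E <= minimax_risk Theta sigma)%E.
Proof.
move=> m0 kmd s0 taule sparseT.
have pos_lt (a : 'I_k) (b : 'I_m) : (a * m + b < d)%N.
  apply: leq_trans kmd; apply: (@leq_trans (a.+1 * m)).
    by rewrite mulSn addnC ltn_add2r.
  by rewrite leq_mul2r ltn_ord orbT.
pose pos a b := Ordinal (pos_lt a b).
have pos_inj a b a' b' : pos a b = pos a' b' -> a = a' /\ b = b'.
  move=> /(congr1 val)/= e; split; apply: val_inj.
    have /(congr1 (divn ^~ m)) := e.
    by rewrite /= !divnMDl// !divn_small// !addn0.
  have /(congr1 (modn ^~ m)) := e.
  by rewrite /= !modnMDl !modn_small.
apply: le_ereal_inf_tmp => _ [f mf <-].
apply: (@worst_risk_ge _ _ _ _ pos) => //; last first.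
  by move=> s; apply: sparseT; [exact: spike_two_valued|exact: sparsity_spike].
have m0' : 0 < m%:R :> R by rewrite ltr0n.
have : tau ^+ 2 / sigma ^+ 2 <= (1 + ln m%:R) / 2.
  by rewrite ler_pdivrMr ?exprn_gt0// mulrC mulrA.
rewrite -ler_expR => /le_trans; apply.
(* Here [E^2 = expR 1 * m <= 4 m <= (m + 1)^2]. *)
set E := expR _.
have EE : E * E <= 4 * m%:R.
  rewrite -expRD -splitr expRD lnK ?posrE//.
  by apply: ler_wpM2r; [exact: ltW|exact: expR1_le4].
have := expR_ge0 ((1 + ln m%:R) / 2 : R); rewrite -/E => E0.
by have := sqr_ge0 (m%:R - 1 : R); nra.
Qed.

End sparse_minimax.

(** * Risk of the projection *)

Section projection_risk.
Context (R : realType) (d : nat).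
Implicit Types (x y theta : d.-tuple R) (Theta : set (d.-tuple R)).
Variables (Theta : set (d.-tuple R)) (sigma : R).
Variable Pi : d.-tuple R -> d.-tuple R.
Hypothesis s0 : 0 < sigma.
Hypothesis projPi : is_projection Theta Pi.

Lemma worst_risk_le_diam (D : R) :
  (forall x y, Theta x -> Theta y -> sqdist x y <= D) -> 0 <= D ->
  (worst_risk Theta sigma Pi <= D%:E)%E.
Proof.
move=> diamD D0; apply: ge_ereal_sup => _ [theta Ttheta <-].
case: projPi => mPi PiP.
apply: le_trans (gaussian_risk_le s0 (lexx 0) D0 (lexx 0) mPi _) _.
  by move=> y; rewrite mul0r addr0; apply: diamD => //; have [] := PiP y.
by rewrite mul0r addr0.
Qed.

Lemma worst_risk_le_noise :
  (worst_risk Theta sigma Pi <= (32 * (d%:R * sigma ^+ 2))%:E)%E.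
Proof.
apply: ge_ereal_sup => _ [theta Ttheta <-].
case: projPi => mPi PiP.
apply: le_trans (gaussian_risk_le s0 (lexx 0) (lexx 0) (ler0n R 4) mPi _) _.
  move=> y; have [_ /(_ theta Ttheta)] := PiP y.
  rewrite add0r mulr0.
  under [X in 4 * X]eq_bigr do rewrite subr0.
  have -> : \sum_(i < d) Num.max 0 `|tnth y i - tnth theta i| ^+ 2 =
      sqdist theta y.
    apply: eq_bigr => i _; rewrite max_r// real_normK ?num_real//.
    by rewrite -sqrrN opprB.
  move=> PiLe.
  (* Minimality of [Pi y] bounds the first distance by the second, hence the factor 4 on the squared
     noise; 32 is [4 * 8]. *)
  have : sqdist (Pi y) theta <= 2 * (sqdist (Pi y) y + sqdist theta y).
    rewrite /sqdist -big_split/= mulr_sumr; apply: ler_sum => i _.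
    have := sqr_ge0 (tnth (Pi y) i - tnth y i + (tnth theta i - tnth y i)).
    nra.
  lra.
rewrite lee_fin expr0n/= mul0r oppr0 expR0; lra.
Qed.

(** If [4 t <= a], the square absorbs the product. Otherwise [a = a^q a^(1-q)] with
    [a^(1-q) <= (4 t)^(1-q) <= 4 t^(1-q)]. *)
Lemma mul_le_sqrD_powR (q a t : R) : 0 < q -> q <= 1 -> 0 <= a -> 0 < t ->
  a * t <= a ^+ 2 / 4 + 4 * (a `^ q * t `^ (2 - q)).
Proof.
move=> q0 q1 a0 t0; have [ta|at0] := leP (4 * t) a.
  have : 0 <= a `^ q * t `^ (2 - q) by rewrite mulr_ge0 ?powR_ge0.
  nra.
have [->|a_neq0] := eqVneq a 0.
  by rewrite mul0r addr_ge0 ?divr_ge0 ?sqr_ge0// !mulr_ge0 ?powR_ge0.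
rewrite ler_wpDl ?divr_ge0 ?sqr_ge0//.
have a1 : a = a `^ q * a `^ (1 - q).
  by rewrite -powRD ?a_neq0 ?implybT// addrC subrK powRr1.
have t2 : t `^ (2 - q) = t `^ (1 - q) * t.
  rewrite -[X in _ * X](powRr1 (ltW t0)) -powRD;
    last by rewrite (gt_eqF t0) implybT.
  by congr (_ `^ _); lra.
have q1' : 0 <= 1 - q by rewrite subr_ge0.
have : a `^ (1 - q) <= 4 * t `^ (1 - q).
  apply: (@le_trans _ _ ((4 * t) `^ (1 - q))).
    by rewrite ge0_ler_powR// ?nnegrE ?ltW// mulr_gt0.
  rewrite powRM; [|by []|exact: ltW].
  have : 4 `^ (1 - q) <= 4 :> R by apply: ler1_powR; lra.
  by have := powR_ge0 t (1 - q); nra.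
move=> h; have aq0 := powR_ge0 a q; rewrite t2 [in leLHS]a1.
rewrite [leRHS](_ : _ = a `^ q * (4 * t `^ (1 - q)) * t); last ring.
by apply: ler_wpM2r; [exact: ltW|exact: ler_wpM2l].
Qed.

Lemma worst_risk_le_powR (q S l : R) : 0 < q -> q <= 1 -> 0 < l -> 0 <= S ->
  (forall x y, Theta x -> Theta y ->
     \sum_i `|tnth x i - tnth y i| `^ q <= S) ->
  (worst_risk Theta sigma Pi <=
   (8 * (S * (2 * (sigma * l)) `^ (2 - q)) +
    64 * (d%:R * sigma ^+ 2 * expR (- (l ^+ 2 / 4))))%:E)%E.
Proof.
move=> q0 q1 l0 S0 powS.
apply: ge_ereal_sup => _ [theta Ttheta <-].
case: projPi => mPi PiP.
set K := 8 * (S * _).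
have K0 : 0 <= K by rewrite !mulr_ge0 ?powR_ge0.
apply: le_trans (gaussian_risk_le s0 (ltW l0) K0 (ler0n R 8) mPi _) _;
  last first.
  rewrite lee_fin lerD2l; lra.
move=> y; have [TPi /(_ theta Ttheta) PiLe] := PiP y.
set e := \sum_i _.
have t0 : 0 < 2 * (sigma * l) by rewrite !mulr_gt0.
pose D i := tnth (Pi y) i - tnth theta i; pose z i := tnth y i - tnth theta i.
(* The basic inequality: expand around [y] and drop a difference that is nonpositive by
   minimality. *)
have Dz : sqdist (Pi y) theta <= \sum_i 2 * (`|D i| * `|z i|).
  have : sqdist (Pi y) theta = sqdist (Pi y) y - sqdist theta y +
      \sum_i 2 * (D i * z i).
    rewrite /sqdist -sumrB -big_split/=; apply: eq_bigr => i _.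
    by rewrite /D /z; ring.
  have : \sum_i 2 * (D i * z i) <= \sum_i 2 * (`|D i| * `|z i|).
    by apply: ler_sum => i _; rewrite ler_wpM2l// -normrM ler_norm.
  lra.
(* With [t = 2 sigma l], the noise below the level and the excess [w] each cost [D^2 / 4], the
   latter by [2 |D| w <= D^2 / 4 + 4 w^2]. Moving the resulting half of the loss to the left doubles
   the other constants. *)
have pointwise i : 2 * (`|D i| * `|z i|) <=
    D i ^+ 2 / 2 + 4 * (`|D i| `^ q * (2 * (sigma * l)) `^ (2 - q)) +
    4 * (Num.max 0 (`|z i| - sigma * l)) ^+ 2.
  have := mul_le_sqrD_powR q0 q1 (normr_ge0 (D i)) t0.
  rewrite real_normK ?num_real//.
  set w := Num.max _ _.
  have wz : `|z i| <= sigma * l + w by rewrite addrC -lerBlDr le_max lexx orbT.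
  have w0 : 0 <= w by rewrite le_max lexx.
  have := ler_wpM2l (normr_ge0 (D i)) wz.
  have := sqr_ge0 (`|D i| - 4 * w).
  have : `|D i| ^+ 2 = D i ^+ 2 by rewrite real_normK ?num_real.
  nra.
have : \sum_i 2 * (`|D i| * `|z i|) <= sqdist (Pi y) theta / 2 +
    4 * (S * (2 * (sigma * l)) `^ (2 - q)) + 4 * e.
  apply: (le_trans (ler_sum _ (fun i _ => pointwise i))).
  rewrite !big_split/= -!mulr_sumr -!mulr_suml lerD2r lerD2l ler_wpM2l//.
  by rewrite ler_wpM2r ?powR_ge0// powS.
rewrite /K; lra.
Qed.

(** The lower bound 1 holds because [Pi] is itself a competitor in the infimum. The bounds [L] and
    [U] make both risks finite and positive, so the extended quotient is a real one. *)
Lemma mle_ratio_bounds (L U C : R) :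
  0 < L -> (L%:E <= minimax_risk Theta sigma)%E ->
  (worst_risk Theta sigma Pi <= U%:E)%E -> U <= C * L ->
  (1%:E <= mle_ratio Theta sigma Pi)%E /\ (mle_ratio Theta sigma Pi <= C%:E)%E.
Proof.
move=> L0 Lmin wU UCL; rewrite /mle_ratio.
have minw : (minimax_risk Theta sigma <= worst_risk Theta sigma Pi)%E.
  by apply: ge_ereal_inf; exists (worst_risk Theta sigma Pi) => //;
    exists Pi => //; case: projPi.
move: (minimax_risk _ _) (worst_risk _ _ _) Lmin wU minw => M W.
case: M => [M| |]; case: W => [W| |]//=; rewrite !lee_fin => LM WU MW.
have M0 : 0 < M by exact: lt_le_trans LM.
rewrite inver gt_eqF//= -EFinM !lee_fin ler_pdivlMr// mul1r ler_pdivrMr//.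
split=> //.
have C0 : 0 <= C.
  by rewrite -(pmulr_lge0 _ L0); apply: le_trans UCL; lra.
have := ler_wpM2l C0 LM; lra.
Qed.

End projection_risk.
(** * Matching the bounds *)

Section regimes.
Context (R : realType) (d : nat).
Variables (Theta : set (d.-tuple R)) (sigma : R).
Variable Pi : d.-tuple R -> d.-tuple R.
Hypothesis d0 : (0 < d)%N.
Hypothesis s0 : 0 < sigma.
Hypothesis projPi : is_projection Theta Pi.

Lemma sqdist_le_sum_sqr (D : R) :
  (forall x, Theta x -> \sum_i tnth x i ^+ 2 <= D) ->
  forall x y, Theta x -> Theta y -> sqdist x y <= 4 * D.
Proof.
move=> TD x y Tx Ty.
have : sqdist x y <= 2 * (\sum_i tnth x i ^+ 2 + \sum_i tnth y i ^+ 2).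
  rewrite /sqdist -big_split/= mulr_sumr; apply: ler_sum => i _.
  by have := sqr_ge0 (tnth x i + tnth y i); nra.
have := TD _ Tx; have := TD _ Ty; lra.
Qed.

(** Blocks of size 1 with [tau = min (sigma, rho) / 2] give the lower bound
    [d min (sigma, rho)^2 / 32]. It is matched by the noise bound if [sigma <= rho], with ratio
    [32 * 32], and by the diameter otherwise. *)
Lemma cube_regime (rho : R) : 0 < rho ->
  (forall tau x, 0 < tau -> tau <= rho -> two_valued tau x -> Theta x) ->
  sigma <= rho \/
    (forall x, Theta x -> \sum_i tnth x i ^+ 2 <= 2 * (d%:R * rho ^+ 2)) ->
  (1%:E <= mle_ratio Theta sigma Pi)%E /\
  (mle_ratio Theta sigma Pi <= 1024%:E)%E.
Proof.
move=> rho0 cubeT sigma_rho.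
have d0' : 0 < d%:R :> R by rewrite ltr0n.
pose tau := Num.min sigma rho / 2.
have min0 : 0 < Num.min sigma rho by rewrite lt_min s0.
have mins : Num.min sigma rho <= sigma by rewrite ge_min lexx.
have minr : Num.min sigma rho <= rho by rewrite ge_min lexx orbT.
have tau0 : 0 < tau by rewrite divr_gt0.
have lb : ((d%:R * tau ^+ 2 / 8)%:E <= minimax_risk Theta sigma)%E.
  apply: (@minimax_risk_sparse_ge _ _ d 1) => //; first by rewrite muln1.
    rewrite ln1 addr0 mulr1 /tau; nra.
  by move=> x tx _; apply: (cubeT tau) => //; rewrite /tau; lra.
have L0 : 0 < d%:R * tau ^+ 2 / 8 by rewrite divr_gt0// mulr_gt0// exprn_gt0.
have [sr|rs] := leP sigma rho.
  apply: (mle_ratio_bounds projPi L0 lb (worst_risk_le_noise s0 projPi)).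
  by rewrite /tau min_l// le_eqVlt; apply/orP; left; apply/eqP; field.
case: sigma_rho => [|sumD]; first by rewrite leNgt rs.
have D0 : 0 <= 4 * (2 * (d%:R * rho ^+ 2)).
  by rewrite !mulr_ge0// ltW.
apply: (mle_ratio_bounds projPi L0 lb
  (worst_risk_le_diam s0 projPi (sqdist_le_sum_sqr sumD) D0)).
rewrite /tau min_r; last exact: ltW.
have : 0 <= d%:R * rho ^+ 2 by rewrite mulr_ge0 ?sqr_ge0.
lra.
Qed.

(** One block of size [d] with spike [r / 2] gives the lower bound [r^2 / 32], against the squared
    diameter bound [4 r^2]. *)
Lemma large_noise_regime (r : R) : 0 < r ->
  (forall tau x, 0 < tau -> tau <= r -> two_valued tau x ->
     (sparsity x <= 1)%N -> Theta x) ->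
  (forall x, Theta x -> \sum_i tnth x i ^+ 2 <= r ^+ 2) ->
  r ^+ 2 <= sigma ^+ 2 * (1 + ln d%:R) ->
  (1%:E <= mle_ratio Theta sigma Pi)%E /\
  (mle_ratio Theta sigma Pi <= 128%:E)%E.
Proof.
move=> r0 sparseT sumT rs.
have lb : ((1%:R * (r / 2) ^+ 2 / 8)%:E <= minimax_risk Theta sigma)%E.
  apply: (@minimax_risk_sparse_ge _ _ 1 d) => //; first by rewrite mul1n.
    have := sqr_ge0 r; nra.
  by move=> x; apply: sparseT; lra.
have L0 : 0 < 1%:R * (r / 2) ^+ 2 / 8 :> R.
  by rewrite mul1r divr_gt0// exprn_gt0// divr_gt0.
have D0 : 0 <= 4 * r ^+ 2 by rewrite mulr_ge0 ?sqr_ge0.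
apply: (mle_ratio_bounds projPi L0 lb
  (worst_risk_le_diam s0 projPi (sqdist_le_sum_sqr sumT) D0)).
by have := sqr_ge0 r; nra.
Qed.

(** Low noise is the cube regime, high noise the one-spike regime; in between, [k] blocks are used.
    The set is described only through sparse vectors and power sums, so that [q = 1] also serves
    balls with [p] slightly above 1; the factor 16 leaves room for them. *)
Lemma sparse_regime (q r : R) : 0 < q -> q <= 1 -> 0 < r ->
  (forall k tau x, 0 < tau -> k%:R * tau `^ q <= r `^ q ->
     two_valued tau x -> (sparsity x <= k)%N -> Theta x) ->
  (forall x y, Theta x -> Theta y ->
     \sum_i `|tnth x i - tnth y i| `^ q <= 16 * r `^ q) ->
  (forall x, Theta x -> \sum_i tnth x i ^+ 2 <= r ^+ 2) ->
  (1%:E <= mle_ratio Theta sigma Pi)%E /\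
  (mle_ratio Theta sigma Pi <= (400 * 400)%:E)%E.
Proof.
move=> q0 q1 r0 sparseT powT sumT.
have d0' : 0 < d%:R :> R by rewrite ltr0n.
have widen (C : R) : C <= 400 * 400 -> (mle_ratio Theta sigma Pi <= C%:E)%E ->
    (mle_ratio Theta sigma Pi <= (400 * 400)%:E)%E.
  by move=> C1 /le_trans; apply; rewrite lee_fin.
have powR_le (a b : R) : 0 < a -> a <= b -> a `^ q <= b `^ q.
  by move=> a0 ab; rewrite ge0_ler_powR ?nnegrE// ?ltW// (lt_le_trans a0).
have [dle|dgt] := leP (d%:R * sigma `^ q) (r `^ q).
  have [|? ?] := @cube_regime sigma s0 _ (or_introl (lexx _)).
    move=> tau x tau0 taus tx; apply: (sparseT d tau) => //; last first.
      by rewrite -[leqRHS]card_ord max_card.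
    apply: le_trans dle; rewrite ler_wpM2l// powR_le//.
  by split=> //; apply: widen; last eassumption; lra.
have [rs|sr] := leP (r ^+ 2) (sigma ^+ 2 * (1 + ln d%:R)).
  have [|? ?] := @large_noise_regime r r0 _ sumT rs.
    move=> tau x tau0 taur tx sx; apply: (sparseT 1%N tau) => //.
    by rewrite mul1r powR_le.
  by split=> //; apply: widen; last eassumption; lra.
have rq0 : 0 < r `^ q by exact: powR_gt0.
have sq0 : 0 < sigma `^ q by exact: powR_gt0.
(* k spikes of height a / 2, where a is about the maximal noise in a block of
   length m = d / k. *)
pose n := d%:R * sigma `^ q / r `^ q.
have n1 : 1 < n by rewrite ltr_pdivlMr// mul1r.
have n0 : 0 < n by exact: lt_trans n1.
have lnn0 : 0 <= ln n by rewrite ln_ge0// ltW.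
have lnd0 : 0 <= ln d%:R :> R by rewrite ln_ge0// ler1n.
have s_le_r : sigma <= r by nra.
have nd : n <= d%:R.
  by rewrite /n ler_pdivrMr// ler_wpM2l// powR_le.
pose l := Num.sqrt (1 + ln n).
have l2 : l ^+ 2 = 1 + ln n by rewrite sqr_sqrtr// addr_ge0.
have l1 : 1 <= l by have := sqrtr_ge0 (1 + ln n); rewrite -/l; nra.
have l0 : 0 < l by exact: lt_le_trans l1.
pose a := sigma * l.
have a0 : 0 < a by rewrite mulr_gt0.
have ar : a <= r.
  have : a ^+ 2 <= r ^+ 2.
    rewrite /a exprMn l2; apply: le_trans (ltW sr).
    by rewrite ler_wpM2l ?sqr_ge0// lerD2l ler_ln// posrE.
  by rewrite ler_pXn2r// nnegrE ltW.
have aq0 : 0 < a `^ q by exact: powR_gt0.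
pose S := r `^ q / a `^ q.
have S1 : 1 <= S by rewrite ler_pdivlMr// mul1r powR_le.
have S0 : 0 < S by exact: lt_le_trans S1.
have Sa : S * a `^ q = r `^ q by rewrite divfK// gt_eqF.
have aqE : a `^ q = sigma `^ q * l `^ q by rewrite powRM// ltW.
have lq1 : 1 <= l `^ q by rewrite -(powRr0 l) ler_powR// ltW.
have nS : n * (S * l `^ q) = d%:R.
  by rewrite /n /S aqE; field; rewrite !gt_eqF ?powR_gt0.
pose k := truncn S.
have k0 : (0 < k)%N by rewrite truncn_gt0.
have k0' : 0 < k%:R :> R by rewrite ltr0n.
have kS : k%:R <= S by rewrite truncn_le ltW.
have Sk : S <= 2 * k%:R.
  have /andP[_ /ltW] := truncn_itv (ltW S0); rewrite -/k -natr1 => h.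
  have : 1 <= k%:R :> R by rewrite ler1n.
  lra.
have Sd : n * S <= d%:R by rewrite -nS ler_wpM2l ?ler_peMr// ltW.
have kd : (k <= d)%N by rewrite -(ler_nat R); nra.
pose m := (d %/ k)%N.
have m0 : (0 < m)%N by rewrite divn_gt0.
(* Integer parts cost a factor 2: [n k <= n S <= d <= (m + 1) k <= 2 m k]. *)
have nm : n <= 2 * m%:R.
  have : d%:R <= (m%:R + 1) * k%:R :> R.
    by rewrite natr1 -natrM ler_nat ltnW// ltn_ceil.
  have : 1 <= m%:R :> R by rewrite ler1n.
  move=> m1 dmk; rewrite -(ler_pM2r k0'); nra.
have ln2 : ln 2 <= 1 :> R.
  by have -> : 2 = 1 + 1 :> R by []; apply: le_ln1Dx; lra.
have lnm0 : 0 <= ln m%:R :> R by rewrite ln_ge0// ler1n.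
have m0' : 0 < m%:R :> R by rewrite ltr0n.
have l2m : l ^+ 2 <= 2 * (1 + ln m%:R).
  have : ln n <= ln 2 + ln m%:R.
    by rewrite -lnM ?posrE// ler_ln ?posrE// mulr_gt0.
  rewrite l2; lra.
have lb : ((k%:R * (a / 2) ^+ 2 / 8)%:E <= minimax_risk Theta sigma)%E.
  apply: (@minimax_risk_sparse_ge _ _ k m) => //.
  - by rewrite mulnC leq_trunc_div.
  - by rewrite /a exprMn exprMn; have := sqr_ge0 sigma; nra.
  - move=> x; apply: sparseT; first by rewrite divr_gt0.
    rewrite -Sa; apply: ler_pM => //; first exact: powR_ge0.
    by apply: powR_le; [rewrite divr_gt0|lra].
have L0 : 0 < k%:R * (a / 2) ^+ 2 / 8.
  by rewrite divr_gt0// mulr_gt0// exprn_gt0// divr_gt0.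
(* The upper bound is taken at level [2 l]: the tail factor becomes [expR (- l^2) <= 1 / n], so the
   excess noise costs at most [d sigma^2 / n = S sigma^2 l^q <= S a^2]. *)
have l20 : 0 < 2 * l by rewrite mulr_gt0.
have rq16 : 0 <= 16 * r `^ q by rewrite mulr_ge0// ltW.
apply: (mle_ratio_bounds projPi L0 lb
  (worst_risk_le_powR s0 projPi q0 q1 l20 rq16 powT)).
have aqa : a `^ q * a `^ (2 - q) = a ^+ 2.
  rewrite -powRD; last by rewrite (gt_eqF a0) implybT.
  by rewrite [q + _]addrC subrK powR_mulrn ?(ltW a0).
have pow4 : (2 * (sigma * (2 * l))) `^ (2 - q) <= 16 * a `^ (2 - q).
  rewrite (_ : 2 * (sigma * (2 * l)) = 4 * a); last by rewrite /a; ring.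
  rewrite powRM//; last exact: ltW.
  rewrite ler_wpM2r ?powR_ge0// (_ : 16 = 4 `^ 2); last first.
    by rewrite powR_mulrn//; lra.
  by rewrite ler_powR; lra.
have expl : expR (- ((2 * l) ^+ 2 / 4)) <= n^-1.
  rewrite (_ : (2 * l) ^+ 2 / 4 = 1 + ln n); last by rewrite -l2; field.
  rewrite -[leRHS]lnK ?posrE ?invr_gt0// ler_expR lnV ?posrE//; lra.
have lql : l `^ q <= l ^+ 2.
  by rewrite -powR_mulrn ?(ltW l0)// ler_powR//; lra.
have dexp : d%:R * sigma ^+ 2 * expR (- ((2 * l) ^+ 2 / 4)) <= S * a ^+ 2.
  apply: (@le_trans _ _ (d%:R * sigma ^+ 2 / n)).
    by rewrite ler_wpM2l// mulr_ge0// sqr_ge0.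
  rewrite -nS (_ : _ / n = S * (sigma ^+ 2 * l `^ q));
    last by field; rewrite gt_eqF.
  by rewrite ler_wpM2l ?(ltW S0)// /a exprMn ler_wpM2l ?sqr_ge0.
have : 16 * r `^ q * (2 * (sigma * (2 * l))) `^ (2 - q) <= 256 * (S * a ^+ 2).
  rewrite -Sa -aqa.
  have := ler_wpM2l (mulr_ge0 (ltW S0) (ltW aq0)) pow4; lra.
(* The upper bound is at most [(8 * 256 + 64) S a^2 <= 4224 k a^2] and the lower one is
   [k a^2 / 32]; [4224 * 32 = 135168] lies below [400 * 400]. *)
have : S * a ^+ 2 <= 2 * k%:R * a ^+ 2 by rewrite ler_wpM2r ?sqr_ge0.
lra.
Qed.

End regimes.

(** * Power sums and membership in l_p balls *)

Section power_sums.
Context (R : realType) (d : nat).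
Implicit Types (y : 'I_d -> R) (x : d.-tuple R) (q s r c tau : R).

Lemma powR1l q : 1 `^ q = 1 :> R.
Proof. by rewrite powR1. Qed.

Lemma powR_le1_antimono q s (t : R) : 0 < q -> q <= s -> 0 <= t -> t <= 1 ->
  t `^ s <= t `^ q.
Proof.
move=> q0 qs; rewrite le_eqVlt => /predU1P[<- _|t0 t1].
  by rewrite !powR0 ?gt_eqF// (lt_le_trans q0).
by rewrite ger_powR// t0.
Qed.

Lemma sum_powR_le1 q s y : 0 < q -> q <= s -> (forall i, 0 <= y i) ->
  \sum_i y i `^ q <= 1 -> \sum_i y i `^ s <= 1.
Proof.
move=> q0 qs y0 sum1; apply: (le_trans _ sum1); apply: ler_sum => i _.
apply: powR_le1_antimono => //.
have : y i `^ q <= 1.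
  apply: (le_trans _ sum1); rewrite (bigD1 i)//= lerDl.
  by apply: sumr_ge0 => j _; exact: powR_ge0.
rewrite leNgt => yq1; rewrite leNgt; apply: contra yq1 => y1.
by rewrite -(powR1l q) gt0_ltr_powR// nnegrE.
Qed.

(** Termwise, the [s]-th power is at most 1 below 1 and at most the [q]-th power above 1. *)
Lemma sum_powR_leD q s y : 0 < s -> s <= q -> (forall i, 0 <= y i) ->
  \sum_i y i `^ s <= d%:R + \sum_i y i `^ q.
Proof.
move=> s0 sq y0; rewrite -[X in X%:R + _]card_ord -sumr_const -big_split/=.
apply: ler_sum => i _; have [y1|y1] := leP (y i) 1.
  apply: ler_wpDr (powR_ge0 _ _) _.
  by rewrite -[leRHS](powR1l s) ge0_ler_powR ?nnegrE//; exact: ltW.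
by rewrite ler_wpDl// ler_powR// ltW.
Qed.

Lemma sum_powR_div q c x : 0 < c ->
  \sum_i (`|tnth x i| / c) `^ q = (\sum_i `|tnth x i| `^ q) / c `^ q.
Proof.
move=> c0; rewrite mulr_suml; apply: eq_bigr => i _.
rewrite powRM ?invr_ge0// ?(ltW c0)// -powR_inv1 ?(ltW c0)// powRAC.
by rewrite powR_inv1 ?powR_ge0.
Qed.

Lemma sum_powR_le q s r x : 0 < q -> q <= s -> 0 < r ->
  \sum_i `|tnth x i| `^ q <= r `^ q -> \sum_i `|tnth x i| `^ s <= r `^ s.
Proof.
move=> q0 qs r0 sumq.
have := @sum_powR_le1 q s (fun i => `|tnth x i| / r) q0 qs.
rewrite !sum_powR_div// !ler_pdivrMr ?powR_gt0// !mul1r; apply => //.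
by move=> i; rewrite divr_ge0// ltW.
Qed.

(** A form of Hölder's inequality weakened by a factor 2. In units of [rho], the half-side of the
    inscribed cube, the [q]-th powers sum to at most [d], and [sum_powR_leD] adds another [d]. *)
Lemma sum_powR_cube q s r x : (0 < d)%N -> 0 < s -> s <= q -> 0 < r ->
  \sum_i `|tnth x i| `^ q <= r `^ q ->
  \sum_i `|tnth x i| `^ s <= 2 * (d%:R * (r / d%:R `^ q^-1) `^ s).
Proof.
move=> d0 s0 sq r0 sumq; set rho := r / _.
have d0' : 0 < d%:R :> R by rewrite ltr0n.
have q0 : 0 < q by exact: lt_le_trans sq.
have rho0 : 0 < rho by rewrite divr_gt0// powR_gt0.
have rhoq : rho `^ q = r `^ q / d%:R.
  rewrite /rho powRM ?invr_ge0 ?powR_ge0 ?(ltW r0)//; congr (_ * _).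
  by rewrite -powRN -powRrM mulNr mulVf ?gt_eqF// powR_inv1 ?(ltW d0').
have := @sum_powR_leD q s (fun i => `|tnth x i| / rho) s0 sq.
rewrite !sum_powR_div// rhoq.
move=> /(_ (fun i => divr_ge0 (normr_ge0 _) (ltW rho0))).
rewrite ler_pdivrMr ?powR_gt0// => /le_trans; apply.
rewrite [leRHS]mulrA ler_wpM2r ?powR_ge0//.
have : (\sum_(i < d) `|tnth x i| `^ q) / (r `^ q / d%:R) <= d%:R.
  rewrite ler_pdivrMr ?divr_gt0 ?powR_gt0// mulrCA divff ?gt_eqF// mulr1//.
lra.
Qed.

Lemma sum_sqr_powR x : \sum_i tnth x i ^+ 2 = \sum_i `|tnth x i| `^ 2.
Proof.
by apply: eq_bigr => i _; rewrite powR_mulrn// real_normK ?num_real.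
Qed.

Lemma sum_powR_two_valued q tau x : 0 < q -> 0 < tau -> two_valued tau x ->
  \sum_i `|tnth x i| `^ q = (sparsity x)%:R * tau `^ q.
Proof.
move=> q0 tau0 tx; rewrite /sparsity mulr_natl -sumr_const [RHS]big_mkcond/=.
apply: eq_bigr => i _; rewrite inE; case: (tx i) => ->.
  by rewrite eqxx normr0 powR0// gt_eqF.
by rewrite gt_eqF// gtr0_norm.
Qed.

(** Bound [|a - b|] by twice the maximum [m]; then [2^q <= 2], and [m^q] is one of the two
    summands. *)
Lemma powR_norm_sub_le q (a b : R) : 0 < q -> q <= 1 ->
  `|a - b| `^ q <= 2 * (`|a| `^ q + `|b| `^ q).
Proof.
move=> q0 q1; pose m := Num.max `|a| `|b|.
have m0 : 0 <= m by rewrite le_max normr_ge0.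
have ab : `|a - b| <= 2 * m.
  have : `|a| <= m by rewrite le_max lexx.
  have : `|b| <= m by rewrite le_max lexx orbT.
  have := ler_normB a b; lra.
apply: (@le_trans _ _ ((2 * m) `^ q)).
  by rewrite ge0_ler_powR ?nnegrE ?mulr_ge0// ltW.
rewrite powRM//; apply: ler_pM; rewrite ?powR_ge0//.
  by rewrite ler1_powR//; lra.
rewrite /m.
by case: (leP `|a| `|b|) => _; [rewrite lerDr|rewrite lerDl]; exact: powR_ge0.
Qed.

Lemma lpballP q r x : 0 < q -> 0 <= r ->
  lpball d q%:E r x <-> \sum_i `|tnth x i| `^ q <= r `^ q.
Proof.
move=> q0 r0; rewrite /lpball/=; set S := \sum_i _.
have S0 : 0 <= S by apply: sumr_ge0 => i _; exact: powR_ge0.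
have powK (t : R) : 0 <= t -> (t `^ q^-1) `^ q = t.
  by move=> t0; rewrite -powRrM mulVf ?gt_eqF// powRr1.
have powVK : (r `^ q) `^ q^-1 = r by rewrite -powRrM divff ?gt_eqF// powRr1.
split=> h.
  by rewrite -[leLHS]powK// ge0_ler_powR ?nnegrE ?powR_ge0// ltW.
by rewrite -[leRHS]powVK ge0_ler_powR ?nnegrE ?powR_ge0// invr_ge0 ltW.
Qed.

Lemma lpball_inftyP r x : 0 <= r ->
  lpball d +oo%E r x <-> forall i, `|tnth x i| <= r.
Proof.
move=> r0; rewrite /lpball/=; split=> [h i|h].
  by apply: le_trans h; apply: le_bigmax_cond.
by apply/bigmax_leP.
Qed.

End power_sums.

(** * The MLE ratio for l_p balls, by range of the exponent *)

Section lpball_ratio.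
Context (R : realType) (d : nat).
Variables (sigma r : R) (Pi : d.-tuple R -> d.-tuple R).
Hypothesis d0 : (0 < d)%N.
Hypothesis s0 : 0 < sigma.
Hypothesis r0 : 0 < r.
Implicit Types (q tau : R) (x : d.-tuple R).

Let d0' : 0 < d%:R :> R. Proof. by rewrite ltr0n. Qed.

Lemma lpball_sparse k q tau x : 0 < q -> 0 < tau ->
  k%:R * tau `^ q <= r `^ q -> two_valued tau x -> (sparsity x <= k)%N ->
  lpball d q%:E r x.
Proof.
move=> q0 tau0 ktau tx sx; apply/(lpballP _ q0 (ltW r0)).
rewrite (sum_powR_two_valued q0 tau0 tx); apply: (le_trans _ ktau).
by rewrite ler_wpM2r ?powR_ge0// ler_nat.
Qed.

Lemma lpball_one_sparse q tau x : 0 < q -> 0 < tau -> tau <= r ->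
  two_valued tau x -> (sparsity x <= 1)%N -> lpball d q%:E r x.
Proof.
move=> q0 tau0 taur; apply: lpball_sparse => //.
by rewrite mul1r ge0_ler_powR ?nnegrE// ltW.
Qed.

Lemma lpball_cube q tau x : 0 < q -> 0 < tau -> tau <= r / d%:R `^ q^-1 ->
  two_valued tau x -> lpball d q%:E r x.
Proof.
move=> q0 tau0 taule tx; apply: (@lpball_sparse d q tau) => //; last first.
  by rewrite -[leqRHS]card_ord max_card.
have : (tau * d%:R `^ q^-1) `^ q <= r `^ q.
  rewrite ge0_ler_powR ?nnegrE ?(ltW r0) ?(ltW q0)//.
    by rewrite mulr_ge0 ?powR_ge0// ltW.
  by rewrite -ler_pdivlMr// powR_gt0.
rewrite powRM ?powR_ge0 ?(ltW tau0)// -powRrM mulVf ?gt_eqF//.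
by rewrite powRr1 ?(ltW d0')// mulrC.
Qed.

Lemma lpball_sum_sqr q x : 0 < q -> q <= 2 -> lpball d q%:E r x ->
  \sum_i tnth x i ^+ 2 <= r ^+ 2.
Proof.
move=> q0 q2 /(lpballP _ q0 (ltW r0)) /(sum_powR_le q0 q2 r0).
by rewrite sum_sqr_powR powR_mulrn// ltW.
Qed.

(** For [q >= 2] the inscribed cube has the Euclidean radius of the ball up to a constant, so the
    cube regime covers every noise level. *)
Lemma mle_ratio_lpball_ge2 q : 2 <= q -> is_projection (lpball d q%:E r) Pi ->
  (1%:E <= mle_ratio (lpball d q%:E r) sigma Pi)%E /\
  (mle_ratio (lpball d q%:E r) sigma Pi <= 1024%:E)%E.
Proof.
move=> q2 projPi; have q0 : 0 < q by exact: lt_le_trans q2.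
have rho0 : 0 < r / d%:R `^ q^-1 by rewrite divr_gt0// powR_gt0.
apply: (cube_regime d0 s0 projPi rho0).
  by move=> tau x; exact: lpball_cube.
right=> x /(lpballP _ q0 (ltW r0)) sumq.
have := sum_powR_cube d0 (ltr0n R 2) q2 r0 sumq.
by rewrite sum_sqr_powR powR_mulrn// ltW.
Qed.

Lemma mle_ratio_lpball_infty : is_projection (lpball d +oo%E r) Pi ->
  (1%:E <= mle_ratio (lpball d +oo%E r) sigma Pi)%E /\
  (mle_ratio (lpball d +oo%E r) sigma Pi <= 1024%:E)%E.
Proof.
move=> projPi; apply: (cube_regime d0 s0 projPi r0).
  move=> tau x tau0 taur tx; apply/(lpball_inftyP _ (ltW r0)) => i.
  by case: (tx i) => ->; rewrite ?normr0 ?gtr0_norm// ltW.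
right=> x /(lpball_inftyP _ (ltW r0)) xr.
apply: (@le_trans _ _ (d%:R * r ^+ 2)).
  rewrite mulr_natl -[X in _ *+ X]card_ord -sumr_const; apply: ler_sum => i _.
  by rewrite -real_normK ?num_real// ler_pXn2r ?nnegrE// ltW.
have : 0 <= d%:R * r ^+ 2 by rewrite mulr_ge0 ?sqr_ge0.
lra.
Qed.

Lemma mle_ratio_lpball_le1 q : 0 < q -> q <= 1 ->
  is_projection (lpball d q%:E r) Pi ->
  (1%:E <= mle_ratio (lpball d q%:E r) sigma Pi)%E /\
  (mle_ratio (lpball d q%:E r) sigma Pi <= (400 * 400)%:E)%E.
Proof.
move=> q0 q1 projPi; apply: (sparse_regime d0 s0 projPi q0 q1 r0).
- by move=> k tau x; exact: lpball_sparse.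
- move=> x y /(lpballP _ q0 (ltW r0)) xr /(lpballP _ q0 (ltW r0)) yr.
  apply: (@le_trans _ _ (\sum_i 2 * (`|tnth x i| `^ q + `|tnth y i| `^ q))).
    by apply: ler_sum => i _; exact: powR_norm_sub_le.
  rewrite -mulr_sumr big_split/=; have := powR_ge0 r q; lra.
- by move=> x; apply: lpball_sum_sqr => //; lra.
Qed.

(** The ball lies between the l_1 balls of radii [r] and [8 r], so the sparse regime applies with
    exponent 1. *)
Lemma mle_ratio_lpball_near1 q : 1 < q -> q <= 1 + 1 / (1 + ln d%:R) ->
  is_projection (lpball d q%:E r) Pi ->
  (1%:E <= mle_ratio (lpball d q%:E r) sigma Pi)%E /\
  (mle_ratio (lpball d q%:E r) sigma Pi <= (400 * 400)%:E)%E.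
Proof.
move=> q1 qle projPi.
have lnd0 : 0 <= ln d%:R :> R by rewrite ln_ge0// ler1n.
have q0 : 0 < q by exact: lt_trans q1.
have q2 : q <= 2.
  apply: (le_trans qle); rewrite -[leRHS]/(1 + 1) lerD2l.
  by rewrite ler_pdivrMr ?mul1r ?lerDl// ltr_wpDr.
(* The logarithm is [(1 - 1/q) ln d <= (q - 1) ln d <= 1]; this is where the threshold on [q]
   enters. *)
have dpow : d%:R / d%:R `^ q^-1 <= 4.
  apply: le_trans (expR1_le4 R).
  rewrite -[X in X / _](powRr1 (ltW d0')) -powRB;
    last by rewrite (gt_eqF d0') implybT.
  rewrite /powR (gt_eqF d0') ler_expR.
  have : (1 - q^-1) * ln d%:R <= (q - 1) * ln d%:R.
    apply: ler_wpM2r => //.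
    have : q^-1 * q = 1 by rewrite mulVf// gt_eqF.
    have : 0 <= q^-1 by rewrite invr_ge0 ltW.
    nra.
  have : (q - 1) * (1 + ln d%:R) <= 1.
    by rewrite -ler_pdivlMr ?ltr_wpDr// lerBlDl.
  lra.
have sum1 x : lpball d q%:E r x -> \sum_i `|tnth x i| <= 8 * r.
  move=> /(lpballP _ q0 (ltW r0)) xr.
  have := sum_powR_cube d0 ltr01 (ltW q1) r0 xr.
  under eq_bigr do rewrite powRr1//.
  move=> /le_trans; apply.
  rewrite powRr1; last by rewrite divr_ge0 ?powR_ge0// ltW.
  rewrite (_ : 2 * _ = 2 * (d%:R / d%:R `^ q^-1) * r); last by ring.
  by rewrite ler_wpM2r ?(ltW r0)//; lra.
apply: (sparse_regime d0 s0 projPi ltr01 (lexx 1) r0).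
- move=> k tau x tau0 ktau tx sx; apply/(lpballP _ q0 (ltW r0)).
  apply: (sum_powR_le ltr01 (ltW q1) r0); apply: le_trans ktau.
  by rewrite (sum_powR_two_valued ltr01 tau0 tx) ler_wpM2r ?powR_ge0// ler_nat.
- move=> x y /sum1 xr /sum1 yr.
  apply: (@le_trans _ _ (\sum_i (`|tnth x i| + `|tnth y i|))).
    by apply: ler_sum => i _; rewrite powRr1// ler_normB.
  rewrite big_split/= powRr1 ?(ltW r0)//; lra.
- by move=> x; exact: lpball_sum_sqr.
Qed.

(** The two noise ranges are exactly those where the inscribed cube, respectively a single spike,
    already gives a matching lower bound. *)
Lemma mle_ratio_lpball_mid q : 1 < q -> q < 2 ->
  is_projection (lpball d q%:E r) Pi ->
  sigma <= r / d%:R `^ q^-1 \/ r / Num.sqrt (1 + ln d%:R) <= sigma ->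
  (1%:E <= mle_ratio (lpball d q%:E r) sigma Pi)%E /\
  (mle_ratio (lpball d q%:E r) sigma Pi <= 1024%:E)%E.
Proof.
move=> q1 q2 projPi; have q0 : 0 < q by exact: lt_trans q1.
case=> [sle|rle].
  have rho0 : 0 < r / d%:R `^ q^-1 by rewrite divr_gt0// powR_gt0.
  apply: (cube_regime d0 s0 projPi rho0); last by left.
  by move=> tau x; exact: lpball_cube.
have lnd0 : 0 <= ln d%:R :> R by rewrite ln_ge0// ler1n.
have lnd1 : 0 < 1 + ln d%:R :> R by rewrite ltr_wpDr.
have [| | |? ratio_le] := large_noise_regime d0 s0 projPi r0.
- by move=> tau x; exact: lpball_one_sparse.
- by move=> x; apply: lpball_sum_sqr => //; exact: ltW.
- rewrite -(sqr_sqrtr (ltW lnd1)) -exprMn ler_pXn2r// ?nnegrE.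
  + by rewrite -ler_pdivrMr ?sqrtr_gt0.
  + exact: ltW.
  + by rewrite mulr_ge0 ?sqrtr_ge0// ltW.
by split=> //; apply: (le_trans ratio_le); rewrite lee_fin ler_nat.
Qed.

End lpball_ratio.

Theorem corollary1 (R : realType) :
  exists c C : R, [/\ 0 < c, c <= C &
    forall (d : nat) (p : \bar R) (sigma r : R)
           (Pi : d.-tuple R -> d.-tuple R),
      (1 <= d)%N -> 0 < sigma -> 0 < r ->
      is_projection (lpball d p r) Pi ->
      [\/ (2%:E <= p)%E,
          (0%:E < p)%E /\ (p <= (1 + 1 / (1 + ln d%:R))%:E)%E |
          [/\ ((1 + 1 / (1 + ln d%:R))%:E < p)%E, (p < 2%:E)%E &
              sigma <= r / (d%:R `^ (1 / fine p)) \/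
              r / Num.sqrt (1 + ln d%:R) <= sigma]] ->
      (c%:E <= mle_ratio (lpball d p r) sigma Pi)%E /\
      (mle_ratio (lpball d p r) sigma Pi <= C%:E)%E].
Proof.
(* The constant 1 comes from [Pi] being an admissible estimator, and [400 * 400] from the sparse
   regime, the costliest one. *)
exists 1, (400 * 400); split; [by []|by lra|].
move=> d p sigma r Pi d0 s0 r0 projPi.
have weaken : forall x : \bar R,
    (1%:E <= x)%E /\ (x <= 1024%:E)%E ->
    (1%:E <= x)%E /\ (x <= (400 * 400)%:E)%E.
  move=> x [x1 xC]; split=> //; apply: (le_trans xC).
  by rewrite lee_fin -natrM ler_nat.
case: p projPi => [q| |] projPi.
- case=> [|[]|[]]; rewrite ?lee_fin ?lte_fin/=.
  + by move=> q2; apply/weaken/mle_ratio_lpball_ge2.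
  + move=> q0 qle; have [q1|q1] := leP q 1.
      exact: mle_ratio_lpball_le1.
    exact: mle_ratio_lpball_near1.
  + move=> qgt q2; rewrite div1r => regime; apply/weaken.
    apply: mle_ratio_lpball_mid => //; apply: le_lt_trans qgt.
    by rewrite lerDl divr_ge0// addr_ge0// ln_ge0// ler1n.
- by move=> _; apply/weaken/mle_ratio_lpball_infty.
(* All three cases are contradictory at [p = -oo], so the junk norm there never matters. *)
- by case=> [|[]|[]].
Qed.
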